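(* Let $n$ be a sample size, let $f$ be any probability density on $\mathbb R^d$, let $K$ be a kernel as in the context, let $\varkappa>0$, and let $\hat f$ be the estimator defined in the context. Then for any $x\in\mathbb R^d$ one has $$|\hat f(x)-f(x)|\le \inf_{h\in\mathcal H}\Big\{4\bar B_h(f,x)+60\sup_{\eta\in\mathcal H,\,\eta\ge h}M_\eta(Q,x)+61M_h(K,x)\Big\}+7\zeta(x)+18\chi(x),$$ where $$\zeta(x):=\sup_{h\in\mathcal H}\big[|\xi_h(x)|-M_h(K,x)\big]_+\ \vee\ \sup_{h,\eta\in\mathcal H}\big[|\xi_{h,\eta}(x)|-M_{h\vee\eta}(Q,x)\big]_+,$$ $$\chi(x):=\max_{g\in\{K,Q\}}\sup_{h\in\mathcal H}\big[|\hat A_h(g,x)-A_h(g,x)|-M_h(g,x)\big]_+ .$$ Furthermore, for any $q\ge1$, if $\varkappa\ge[\|K\|_\infty\vee1]^2[(4d+2)q+4(d+1)]$, then $$\int_{\mathbb R^d}\mathbb E_f\big\{[\zeta(x)]^q+[\chi(x)]^q\big\}\,dx\le C n^{-q/2},\qquad\forall n\ge3,$$ where $C$ is a constant depending on $d$, $q$ and $\|K\|_\infty$ only.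
   Context: $X_1,\dots,X_n$ are i.i.d. random vectors in $\mathbb R^d$ with density $f$; $\mathbb E_f$ is the corresponding expectation. Operations $u/v$, $u\vee v$, $u\wedge v$, products and inequalities between vectors are coordinate-wise; $[a]_+=\max(a,0)$. Kernel: $K:\mathbb R^d\to\mathbb R$ is continuous, supported on $[-1/2,1/2]^d$, $\int K=1$, $\|K\|_\infty<\infty$. Bandwidth set: $\mathcal H=\{h\in(0,1]^d: h_j=2^{-k_j},\ k_j=0,\dots,\log_2 n,\ j=1,\dots,d\}$ ($\log_2 n$ is assumed to be an integer). For $h\in\mathcal H$: $V_h=\prod_j h_j$ and, for any function $g$ on $\mathbb R^d$, $g_h(\cdot)=V_h^{-1}g(\cdot/h)$. Put $K_{h,\eta}(t)=[K_h*K_\eta](t)=\int K_h(t-y)K_\eta(y)\,dy$ and $$\hat f_h(x)=\frac1n\sum_{i=1}^nK_h(X_i-x),\qquad \hat f_{h,\eta}(x)=\frac1n\sum_{i=1}^nK_{h,\eta}(X_i-x).$$ Let $Q_{h,\eta}(t)=V_{h\vee\eta}\,[K_h*K_\eta]\big((h\vee\eta)t\big)$, so that $[K_h*K_\eta](t)=V_{h\vee\eta}^{-1}Q_{h,\eta}(t/(h\vee\eta))$, and $Q(t)=\sup_{h,\eta\in\mathcal H}|Q_{h,\eta}(t)|$. Stochastic errors: $\xi_h(x)=\hat f_h(x)-\int K_h(t-x)f(t)\,dt$ and $\xi_{h,\eta}(x)=\hat f_{h,\eta}(x)-\int K_{h,\eta}(t-x)f(t)\,dt$. For $g:\mathbb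 R^d\to\mathbb R$ let $$A_h(g,x)=\int|g_h(t-x)|f(t)\,dt,\qquad \hat A_h(g,x)=\frac1n\sum_{i=1}^n|g_h(X_i-x)|,$$ $$M_h(g,x)=\sqrt{\frac{\varkappa A_h(g,x)\ln n}{nV_h}}+\frac{\varkappa\ln n}{nV_h},\qquad \hat M_h(g,x)=4\sqrt{\frac{\varkappa \hat A_h(g,x)\ln n}{nV_h}}+\frac{4\varkappa\ln n}{nV_h}.$$ Selection rule: for $x\in\mathbb R^d$, $h\in\mathcal H$, $$\hat R_h(x)=\sup_{\eta\in\mathcal H}\Big[|\hat f_{h,\eta}(x)-\hat f_\eta(x)|-\hat M_{h\vee\eta}(Q,x)-\hat M_\eta(K,x)\Big]_++\sup_{\eta\in\mathcal H,\,\eta\ge h}\hat M_\eta(Q,x)+\hat M_h(K,x),$$ $\hat h(x)\in\arg\min_{h\in\mathcal H}\hat R_h(x)$ (a measurable choice of minimizer) and $\hat f(x)=\hat f_{\hat h(x)}(x)$. Bias: $B_h(f,t)=\int K_h(y-t)f(y)\,dy-f(t)$ and $$\bar B_h(f,x)=|B_h(f,x)|\vee\sup_{\eta\in\mathcal H}\Big|\int K_\eta(t-x)B_h(f,t)\,dt\Big|.$$ *)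

(* Defs.v *)
From HB Require Import structures.
From mathcomp Require Import all_boot all_order all_algebra.
From mathcomp Require Import all_classical all_reals all_analysis.

Set Implicit Arguments.
Unset Strict Implicit.
Unset Printing Implicit Defensive.

Import Order.TTheory GRing.Theory Num.Theory.
Import numFieldNormedType.Exports.

Local Open Scope classical_set_scope.
Local Open Scope ring_scope.

Definition measure_rV_display : measure_display -> measure_display.
Proof. exact. Qed.

(* The library has no sigma-algebra on matrices.  Row vectors get the product
   sigma-algebra, i.e. the one generated by the coordinate maps; on 'rV[R]_n it
   is the Borel sigma-algebra. *)
Section measurable_rV.
Context {d} {T : measurableType d}.
Variable n : nat.

Let coord (i : 'I_n) (x : 'rV[T]_n) : T := x ord0 i.

Let rV_set0 : g_sigma_preimage coord set0.
Proof. exact: sigma_algebra0. Qed.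

Let rV_setC A : g_sigma_preimage coord A -> g_sigma_preimage coord (~` A).
Proof. exact: sigma_algebraC. Qed.

Let rV_bigcup (F : _^nat) : (forall i, g_sigma_preimage coord (F i)) ->
  g_sigma_preimage coord (\bigcup_i (F i)).
Proof. exact: sigma_algebra_bigcup. Qed.

HB.instance Definition _ := @isMeasurable.Build (measure_rV_display d)
  'rV[T]_n (g_sigma_preimage coord) rV_set0 rV_setC rV_bigcup.

End measurable_rV.

Lemma measurable_coord d (T : measurableType d) n (i : 'I_n) :
  measurable_fun [set: 'rV[T]_n] (fun x : 'rV[T]_n => x ord0 i).
Proof.
move=> _ Y mY; rewrite setTI; apply: sub_sigma_algebra => /=.
rewrite -bigcup_seq/=; exists i => /=; first by rewrite mem_index_enum.
by exists Y => //; rewrite setTI.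
Qed.

Lemma measurable_fun_rV d1 d2 (T1 : measurableType d1) (T2 : measurableType d2)
    n (f : T1 -> 'rV[T2]_n) :
  (forall i, measurable_fun [set: T1] (fun t => f t ord0 i)) ->
  measurable_fun [set: T1] f.
Proof.
move=> mf _ A mA; rewrite setTI.
suff : measurable `<=` image_set_system setT f measurable.
  by move=> /(_ A mA); rewrite /image_set_system/= setTI.
apply: smallest_sub.
  by apply: sigma_algebra_image; exact: sigma_algebra_measurable.
rewrite -bigcup_seq; apply: bigcup_sub => i _ B [C mC <-].
rewrite /image_set_system/= !setTI.
by have := mf i measurableT C mC; rewrite setTI.
Qed.

Section lebesgue_rV.
Variable R : realType.
Local Open Scope ereal_scope.

Definition rV_cons n (p : measurableTypeR R * 'rV[R]_n) : 'rV[R]_n.+1 :=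
  \row_i (if unlift ord0 i is Some j then p.2 ord0 j else p.1).

Definition rV_uncons n (v : 'rV[R]_n.+1) : measurableTypeR R * 'rV[R]_n :=
  (v ord0 ord0, \row_j v ord0 (lift ord0 j)).

Lemma rV_consK n : cancel (@rV_cons n) (@rV_uncons n).
Proof.
move=> [a w]; rewrite /rV_uncons /rV_cons mxE unlift_none; congr pair.
by apply/rowP => j; rewrite !mxE liftK.
Qed.

Lemma measurable_rV_cons n : measurable_fun setT (@rV_cons n).
Proof.
apply: measurable_fun_rV => i; rewrite /rV_cons.
under eq_fun do rewrite mxE.
case: (unlift ord0 i) => [j|]; last exact: measurable_fst.
apply: (@measurableT_comp _ _ _ _ _ _ (fun v : 'rV[R]_n => v ord0 j)) => //.
exact: measurable_coord.
Qed.

Lemma measurable_rV_uncons n : measurable_fun setT (@rV_uncons n).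
Proof.
apply/measurable_fun_pairP; split; first exact: measurable_coord.
apply: measurable_fun_rV => j; under eq_fun do rewrite mxE.
exact: measurable_coord.
Qed.

Section cons_measure.
Variables (n : nat) (m : {sigma_finite_measure set 'rV[R]_n -> \bar R}).

Definition rV_cons_measure : set 'rV[R]_n.+1 -> \bar R :=
  pushforward (@lebesgue_measure R \x m) (@rV_cons n).

Let rV_cons0 : rV_cons_measure set0 = 0.
Proof. by rewrite /rV_cons_measure /pushforward preimage_set0 measure0. Qed.

Let rV_cons_ge0 A : 0 <= rV_cons_measure A.
Proof. exact: (measure_ge0 (@lebesgue_measure R \x m)). Qed.

Let rV_cons_sigma_additive : semi_sigma_additive rV_cons_measure.
Proof.
exact: (@measure_semi_sigma_additive _ _ _
  (measure_function_pushforward__canonical__measure_function_Measure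
    _ (@measurable_rV_cons n))).
Qed.

HB.instance Definition _ := isMeasure.Build _ _ _ rV_cons_measure
  rV_cons0 rV_cons_ge0 rV_cons_sigma_additive.

Let rV_cons_sigma_finite : sigma_finite setT rV_cons_measure.
Proof.
have /sigma_finiteP[F [TF ndF Foo]] := sigma_finiteT (@lebesgue_measure R).
have /sigma_finiteP[G [TG ndG Goo]] := sigma_finiteT m.
exists (fun k => @rV_uncons n @^-1` (F k `*` G k)).
  rewrite -preimage_bigcup -[LHS](preimage_setT (@rV_uncons n)); congr (_ @^-1` _).
  rewrite -setXTT TF TG predeqE => -[x y]; split.
    move=> [/= [i _ Fix] [k _ Gky]]; exists (maxn i k) => //; split.
    - by move: x Fix; exact/subsetPset/ndF/leq_maxl.
    - by move: y Gky; exact/subsetPset/ndG/leq_maxr.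
  by move=> [k _ []/= ? ?]; split; exists k.
move=> k; have [mF Fk] := Foo k; have [mG Gk] := Goo k; split.
  rewrite -[X in measurable X]setTI; apply: measurable_rV_uncons => //.
  exact: measurableX.
rewrite /rV_cons_measure /pushforward -comp_preimage.
rewrite (_ : _ \o _ = id); last by apply/funext => p; exact: rV_consK.
by rewrite preimage_id product_measure1E// lte_mul_pinfty// ge0_fin_numE.
Qed.

HB.instance Definition _ := Measure_isSigmaFinite.Build _ _ _
  rV_cons_measure rV_cons_sigma_finite.

End cons_measure.

(* Lebesgue measure on R^n: the n-fold product of lebesgue_measure,
   transported to row vectors (see lebesgue_rV_box). *)
Fixpoint lebesgue_rV n : {sigma_finite_measure set 'rV[R]_n -> \bar R} :=
  match n with
  | 0 => \d_(0%R : 'rV[R]_0)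
  | n'.+1 => rV_cons_measure (lebesgue_rV n')
  end.

Lemma lebesgue_rV_box n (A : 'I_n -> set (measurableTypeR R)) :
  (forall i, measurable (A i)) ->
  lebesgue_rV n [set v | forall i, A i (v ord0 i)]
  = \prod_(i < n) lebesgue_measure (A i).
Proof.
elim: n A => [|n IH] A mA.
  by rewrite big_ord0 /= diracE mem_set// => -[].
have mB : measurable
    [set v : 'rV[R]_n | forall i, A (lift ord0 i) (v ord0 i)].
  rewrite (_ : [set v | _] = \bigcap_(i in [set: 'I_n])
    ((fun v : 'rV[R]_n => v ord0 i) @^-1` A (lift ord0 i))); last first.
    by apply/seteqP; split => v /= h i; [move=> _; exact: h|exact: h].
  apply: fin_bigcap_measurable => // i _; rewrite -[X in measurable X]setTI.
  by apply: measurable_coord => //; exact: mA.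
rewrite big_ord_recl /= /rV_cons_measure /pushforward.
rewrite -IH// -[RHS](product_measure1E _ _ (mA ord0) mB).
congr (_ _); apply/seteqP; split => -[a w] /=; rewrite /rV_cons/=.
  move=> h; split; first by have := h ord0; rewrite mxE unlift_none.
  by move=> i; have := h (lift ord0 i); rewrite mxE liftK.
move=> [Aa Aw] i; rewrite mxE; by case: unliftP => [j ->|->].
Qed.

End lebesgue_rV.

(* Points of R^d are row vectors.  Real-valued integrals are Rintegral
   (fine of the Lebesgue integral); for h in bandwidths n, under is_kernel and
   is_density, every integrand below is integrable.  Every sup and inf over bandwidths is over a
   finite nonempty set of reals, hence attained. *)
Section kernel_estimators.
Variables (R : realType) (d : nat).
Local Notation leb := (@lebesgue_rV R d).
Implicit Types (h eta t x : 'rV[R]_d) (g K f : 'rV[R]_d -> R) (kappa : R).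

Definition le_rV h eta := forall j, h ord0 j <= eta ord0 j.

Definition max_rV h eta : 'rV[R]_d := map2_mx Num.max h eta.
Definition mul_rV h t : 'rV[R]_d := map2_mx *%R h t.
Definition div_rV t h : 'rV[R]_d := map2_mx (fun a b => a / b) t h.

Definition pos_part (a : R) : R := Num.max a 0.

(* trunc_log 2 n is log_2 n when n is a power of 2. *)
Definition bandwidths (n : nat) : set 'rV[R]_d :=
  [set h | forall j,
     exists2 k, (k <= trunc_log 2 n)%N & h ord0 j = 2^-1 ^+ k].

Definition vol h : R := \prod_j h ord0 j.

Definition rescale g h : 'rV[R]_d -> R :=
  fun t => (vol h)^-1 * g (div_rV t h).

(* For continuous g this is also the essential supremum of |g|. *)
Definition supnorm g : R := sup [set `|g t| | t in [set: 'rV[R]_d]].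

Definition is_kernel K :=
  [/\ continuous K,
      forall t, (exists j, 2^-1 < `|t ord0 j|) -> K t = 0,
      \int[leb]_t K t = 1 &
      has_ubound [set `|K t| | t in [set: 'rV[R]_d]]].

Definition is_density f :=
  [/\ measurable_fun [set: 'rV[R]_d] f,
      forall t, 0 <= f t &
      (\int[leb]_t (f t)%:E = 1)%E].

(* The convolution K_{h,eta} = K_h * K_eta. *)
Definition conv2 K h eta : 'rV[R]_d -> R :=
  fun t => \int[leb]_y (rescale K h (t - y) * rescale K eta y).

Definition Qpair K h eta : 'rV[R]_d -> R :=
  fun t => vol (max_rV h eta) * conv2 K h eta (mul_rV (max_rV h eta) t).

Definition Qsup n K : 'rV[R]_d -> R :=
  fun t => sup [set `|Qpair K h eta t| | h in bandwidths n
                                       & eta in bandwidths n].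

Definition bias K h f : 'rV[R]_d -> R :=
  fun t => \int[leb]_y (rescale K h (y - t) * f y) - f t.

Definition max_bias n K h f x : R :=
  Num.max `|bias K h f x|
    (sup [set `| \int[leb]_t (rescale K eta (t - x) * bias K h f t) |
         | eta in bandwidths n]).

Definition Aex f g h x : R := \int[leb]_t (`|rescale g h (t - x)| * f t).

Definition majorant n kappa f g h x : R :=
  Num.sqrt (kappa * Aex f g h x * ln n%:R / (n%:R * vol h))
  + kappa * ln n%:R / (n%:R * vol h).

Section data_driven.
(* xs is a realization of the sample X_1, ..., X_n. *)
Variables (n : nat) (xs : 'I_n -> 'rV[R]_d) (kappa : R) (K : 'rV[R]_d -> R).
Local Notation H := (bandwidths n).
Local Notation Q := (Qsup n K).

Definition fhat h x : R := n%:R^-1 * \sum_i rescale K h (xs i - x).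

Definition fhat2 h eta x : R := n%:R^-1 * \sum_i conv2 K h eta (xs i - x).

Definition Ahat g h x : R := n%:R^-1 * \sum_i `|rescale g h (xs i - x)|.

Definition majorant_hat g h x : R :=
  4 * Num.sqrt (kappa * Ahat g h x * ln n%:R / (n%:R * vol h))
  + 4 * kappa * ln n%:R / (n%:R * vol h).

Definition Rhat h x : R :=
  sup [set pos_part (`|fhat2 h eta x - fhat eta x|
                     - majorant_hat Q (max_rV h eta) x
                     - majorant_hat K eta x)
      | eta in H]
  + sup [set majorant_hat Q eta x | eta in [set eta | H eta /\ le_rV h eta]]
  + majorant_hat K h x.

Definition is_argmin_Rhat x h :=
  H h /\ forall eta, H eta -> Rhat h x <= Rhat eta x.

Variable f : 'rV[R]_d -> R.

Definition xi h x : R :=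
  fhat h x - \int[leb]_t (rescale K h (t - x) * f t).

Definition xi2 h eta x : R :=
  fhat2 h eta x - \int[leb]_t (conv2 K h eta (t - x) * f t).

Definition zeta x : R :=
  Num.max
    (sup [set pos_part (`|xi h x| - majorant n kappa f K h x) | h in H])
    (sup [set pos_part (`|xi2 h eta x| - majorant n kappa f Q (max_rV h eta) x)
         | h in H & eta in H]).

Definition chi_of g x : R :=
  sup [set pos_part (`|Ahat g h x - Aex f g h x| - majorant n kappa f g h x)
      | h in H].

Definition chi x : R := Num.max (chi_of K x) (chi_of Q x).

Definition oracle_bound x : R :=
  inf [set 4 * max_bias n K h f x
           + 60 * sup [set majorant n kappa f Q eta x
                      | eta in [set eta | H eta /\ le_rV h eta]]
           + 61 * majorant n kappa f K h x
      | h in H].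

End data_driven.
End kernel_estimators.

Section sampling.
Context {R : realType} {d n : nat} {dO : measure_display}
  {Omega : measurableType dO} (P : probability Omega R).
Implicit Types (X : 'I_n -> {RV P >-> 'rV[R]_d}) (K f : 'rV[R]_d -> R).
Local Open Scope ereal_scope.

(* Product rule over every finite subfamily. *)
Definition mutually_independent X :=
  forall (J : {set 'I_n}) (A : 'I_n -> set 'rV[R]_d),
    (forall i, measurable (A i)) ->
    P (\bigcap_(i in [set` J]) X i @^-1` A i)
    = \prod_(i in J) P (X i @^-1` A i).

Definition iid_with_density X f :=
  mutually_independent X /\
  forall i (A : set 'rV[R]_d), measurable A ->
    distribution P (X i) A = \int[@lebesgue_rV R d]_(t in A) (f t)%:E.

(* No measurability jointly in (x, w) is required: for each x, hhat x is a
   random vector. *)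
Definition is_bandwidth_selector X kappa K
    (hhat : 'rV[R]_d -> Omega -> 'rV[R]_d) :=
  forall x, measurable_fun [set: Omega] (hhat x) /\
    forall w, is_argmin_Rhat (X^~ w) kappa K x (hhat x w).

End sampling.

(* Main.v *)
Require Import Defs.
From HB Require Import structures.
From mathcomp Require Import all_boot all_order all_algebra.
From mathcomp Require Import all_classical all_reals all_analysis.
From mathcomp Require Import measurable_realfun.
From mathcomp Require Import ring lra.
Set Implicit Arguments.
Unset Strict Implicit.
Unset Printing Implicit Defensive.
Import Order.TTheory GRing.Theory Num.Theory.
Import numFieldNormedType.Exports.
Local Open Scope classical_set_scope.
Local Open Scope ring_scope.

(** The oracle inequality is deterministic.  For a bandwidth [h] and the selected
    bandwidth [hh], the estimators [f_h] and [f_hh] are both close to the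
    convolved estimator [f_{h, hh}], which is symmetric in its two bandwidths
    ([conv2C]); the selection criterion is built so that the two distances add up
    to at most [Rhat h + Rhat hh <= 2 * Rhat h].  It remains to bound [Rhat h].  The
    difference of [f_{h, eta}] and [f_eta] has as its mean the bias of [f_h]
    smoothed by [K_eta] ([smoothed_bias], a use of Fubini's theorem), and its
    noise is controlled by [zeta] and the majorants.  The empirical majorants
    may replace the true ones up to constants and [chi], because the inequality
    defining [chi] is quadratic in the square roots involved
    ([majorant_compare]).

    For the moment bound, every error in [zeta] and [chi] is the deviation of
    an empirical mean of some [phi] with [`|phi| <= b = B / vol h] from its
    expectation, in excess of [sqrt (a * lam) + lam], where [a] bounds the first absolute
    moment of [phi] and [lam = kappa * ln n / (n * vol h)].  Bernstein's inequality
    makes this excess possible only with probability at most [2 * n ^ (- D / 2)],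
    where [D] is the constant in the lower bound on [kappa].  That is not enough,
    since this probability has to be integrated over all of the space.  The
    remedy is [deviation_prob], which gains the factor [n * a / b] over Bernstein: where
    [a] is tiny, an excess requires that the [phi (X_i)] be large in spite of
    their small mean, and Markov's inequality for their Laplace transform minus
    one is proportional to [a].  Now [a / b] is at most the mass that the density
    gives to the sup-norm unit ball around [x] ([Aex_le]), whose integral over [x] is [2 ^ d]
    ([integral_cube_mass]).  A deviation never exceeds a multiple of [n ^ d] and
    there are at most [n ^ (2 * d)] pairs of bandwidths, so that a union bound
    leaves a power of [n] below [- q / 2] ([integrated_moment_le]).

    The Laplace transform of a sum of independent variables is a product by
    [expectation_prod], which is derived here from the product rule for events. *)

(** * Borel sets and Lebesgue measure on row vectors *)

Section nonneg_integral.
Local Open Scope ereal_scope.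

(** The integral of a nonnegative function is a supremum over the simple
    functions below it, so that it is monotone even when neither side is known
    to be measurable.  The error terms are suprema of functions of the point
    and of the sample; their joint measurability is thereby never at stake. *)
Lemma le_nonneg_integral d (T : measurableType d) (R : realType)
    (mu : {measure set T -> \bar R}) (u v : T -> \bar R) :
  (forall x, 0 <= u x) -> (forall x, u x <= v x) ->
  \int[mu]_x u x <= \int[mu]_x v x.
Proof.
move=> u0 uv; have v0 x : 0 <= v x := le_trans (u0 x) (uv x).
rewrite !ge0_integralTE//; apply: le_ereal_sup => _ /= [g gu <-].
by exists g => // x; exact: le_trans (gu x) (uv x).
Qed.

Lemma lee_prod (R : realDomainType) (I : Type) (s : seq I) (x y : I -> \bar R) :
  (forall i, 0 <= x i <= y i) -> \prod_(i <- s) x i <= \prod_(i <- s) y i.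
Proof.
move=> xy; suff /andP[//] : 0 <= \prod_(i <- s) x i <= \prod_(i <- s) y i.
elim/big_ind2: _ => // [|x1 x2 y1 y2 /andP[x10 x12] /andP[y10 y12]].
  by rewrite lee01/=.
by rewrite mule_ge0//= lee_pmul.
Qed.

End nonneg_integral.

Section row_vectors.
Variable R : realType.
Implicit Types n : nat.

Lemma measurable_box n (A : 'I_n -> set (measurableTypeR R)) :
  (forall i, measurable (A i)) ->
  measurable [set v : 'rV[R]_n | forall i, A i (v ord0 i)].
Proof.
move=> mA; rewrite (_ : [set v | _] = \bigcap_(i in [set: 'I_n])
    ((fun v : 'rV[R]_n => v ord0 i) @^-1` A i)); last first.
  by apply/seteqP; split => v /= h i; [move=> _; exact: h|exact: h].
apply: fin_bigcap_measurable => // i _; rewrite -[X in measurable X]setTI.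
by apply: measurable_coord => //; exact: mA.
Qed.

(** An open set is the union of the countably many rational boxes it
    contains, hence belongs to the product sigma-algebra. *)
Lemma open_measurable_rV n (A : set 'rV[R]_n) : open A -> measurable A.
Proof.
move=> oA.
pose B (p : 'rV[rat]_n * nat) : set 'rV[R]_n :=
  [set v | forall j, `|v ord0 j - ratr (p.1 ord0 j)| < p.2.+1%:R^-1].
have mB p : measurable (B p).
  apply: (@measurable_box n (fun j =>
    [set r : R | `|r - ratr (p.1 ord0 j)| < p.2.+1%:R^-1])) => j.
  rewrite (_ : [set r | _] = `]ratr (p.1 ord0 j) - p.2.+1%:R^-1,
      ratr (p.1 ord0 j) + p.2.+1%:R^-1[%classic).
    exact: measurable_itv.
  by apply/seteqP; split => r /=; rewrite in_itv/= ltr_distl.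
pose C p := if pselect (B p `<=` A) is left _ then B p else set0.
rewrite (_ : A = \bigcup_p C p).
  apply: countable_bigcupT_measurable => [|p]; first exact: countableP.
  by rewrite /C; case: pselect => // _.
apply/seteqP; split => [x Ax|x [p _]]; last first.
  by rewrite /C; case: pselect => // BA /BA.
have /nbhs_ballP[e /= e0 eA] := open_nbhs_nbhs (conj oA Ax).
have [k ke] : exists k : nat, k.+1%:R^-1 < e / 2.
  exists (Num.truncn (e / 2)^-1).
  rewrite invf_plt ?posrE ?divr_gt0//; exact: truncnS_gt.
have /choice[q qx] j : exists q : rat,
    `|x ord0 j - ratr q| < (k.+1%:R^-1 : R).
  have : x ord0 j - k.+1%:R^-1 < x ord0 j + k.+1%:R^-1.
    by rewrite ltrD2l gtrN// invr_gt0.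
  move=> /rat_in_itvoo[q]; rewrite in_itv/= => qx; exists q.
  by rewrite distrC ltr_distl.
exists (\row_j q j, k) => //; rewrite /C; case: pselect => [_ j|[]].
  by rewrite /= mxE.
move=> y By; apply: eA; split => // i j; rewrite ord1.
rewrite /ball/= -(subrK (ratr (q j)) (x ord0 j)) -addrA.
have := By j; rewrite /= mxE distrC => yq.
rewrite (splitr e) (le_lt_trans (ler_normD _ _))//.
by rewrite ltrD// (lt_trans _ ke).
Qed.

Lemma continuous_measurable_rV n (g : 'rV[R]_n -> R) :
  continuous g -> measurable_fun [set: 'rV[R]_n] g.
Proof.
move=> cg; apply: (measurability _ (RGenOpens.measurableE R)).
move=> _ [_ [a [b ->] <-]]; rewrite setTI.
by apply: open_measurable_rV; move/continuousP : cg; apply; exact: interval_open.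
Qed.

Lemma ge0_integral_rVS n (g : 'rV[R]_n.+1 -> \bar R) :
  measurable_fun [set: 'rV[R]_n.+1] g -> (forall v, 0 <= g v)%E ->
  (\int[lebesgue_rV R n.+1]_v g v =
   \int[lebesgue_measure]_a \int[lebesgue_rV R n]_w g (rV_cons (a, w)))%E.
Proof.
move=> mg g0; rewrite [LHS](ge0_integral_pushforward (@measurable_rV_cons R n)
  (@lebesgue_measure R \x lebesgue_rV R n)%E measurableT mg)//.
rewrite preimage_setT fubini_tonelli1//; last by move=> p; exact: g0.
by apply: measurableT_comp => //; exact: measurable_rV_cons.
Qed.

Let refl1 (c : R) : measurableTypeR R -> measurableTypeR R := fun y => c - y.

Let measurable_refl1 c : measurable_fun setT (refl1 c).
Proof. exact: measurable_funB. Qed.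

Lemma lebesgue_measure_refl (c : R) (A : set (measurableTypeR R)) :
  measurable A ->
  pushforward lebesgue_measure (refl1 c) A = lebesgue_measure A.
Proof.
move=> mA; apply/esym.
pose nu : {measure set (measurableTypeR R) -> \bar R} :=
  measure_function_pushforward__canonical__measure_function_Measure
    (@lebesgue_measure R) (measurable_refl1 c).
apply: (@lebesgue_measure_unique R nu) => //= _ [[a b]] _ <-.
rewrite /pushforward (_ : _ @^-1` _ = `[c - b, c - a[%classic); last first.
  by apply/seteqP; split => y /=; rewrite /refl1 !in_itv/=; lra.
rewrite !lebesgue_measure_itv/= !lte_fin -EFinB.
have -> : (c - b < c - a) = (a < b) by apply/idP/idP; lra.
by case: ifP => // _; congr EFin; lra.
Qed.

Lemma ge0_integral_refl1 (c : R) (g : measurableTypeR R -> \bar R) :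
  measurable_fun setT g -> (forall a, 0 <= g a)%E ->
  (\int[lebesgue_measure]_a g (c - a)%R = \int[lebesgue_measure]_a g a)%E.
Proof.
move=> mg g0.
have := ge0_integral_pushforward (measurable_refl1 c) (@lebesgue_measure R)
  measurableT mg.
rewrite preimage_setT => <- //.
apply: eq_measure_integral => A mA _; exact: lebesgue_measure_refl.
Qed.

Lemma measurable_rVB n d (T : measurableType d) (u v : T -> 'rV[R]_n) :
  measurable_fun setT u -> measurable_fun setT v ->
  measurable_fun setT (fun x => u x - v x).
Proof.
move=> mu mv; apply: measurable_fun_rV => i; under eq_fun do rewrite !mxE.
by apply: measurable_funB; apply: (measurableT_comp (measurable_coord _)).
Qed.

(** Invariance of Lebesgue measure under the reflections [y |-> c - y], one
    coordinate at a time.  Translations need no separate treatment, being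
    products of two reflections. *)
Lemma ge0_integral_refl n (c : 'rV[R]_n) (g : 'rV[R]_n -> \bar R) :
  measurable_fun [set: 'rV[R]_n] g -> (forall v, 0 <= g v)%E ->
  (\int[lebesgue_rV R n]_v g (c - v)%R = \int[lebesgue_rV R n]_v g v)%E.
Proof.
elim: n c g => [|n IH] c g mg g0.
  by apply: eq_integral => v _; congr g; apply/rowP => -[].
have mgc : measurable_fun [set: 'rV[R]_n.+1] (fun v => g (c - v)).
  by apply: measurableT_comp => //; exact: measurable_rVB.
rewrite !ge0_integral_rVS//.
pose c' : 'rV[R]_n := \row_j c ord0 (lift ord0 j).
have rc a w : c - rV_cons (a, w) = rV_cons (c ord0 ord0 - a, c' - w).
  apply/rowP => i; rewrite !mxE; case: unliftP => [j ->|->] //=.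
  by rewrite !mxE.
have mg2 a : measurable_fun [set: 'rV[R]_n] (fun w => g (rV_cons (a, w))).
  apply: measurableT_comp => //; apply: measurableT_comp.
    exact: measurable_rV_cons.
  exact: measurable_fun_pair.
under eq_integral => a _.
  under eq_integral do rewrite rc.
  rewrite (IH c' (fun w => g (rV_cons (c ord0 ord0 - a, w))))//.
  over.
rewrite (ge0_integral_refl1 (c ord0 ord0)
  (g := fun a => \int[lebesgue_rV R n]_w g (rV_cons (a, w)))%E)//.
- apply: (measurable_fun_fubini_tonelli_F (fun p => g (rV_cons p))) => //.
  by apply: measurableT_comp => //; exact: measurable_rV_cons.
- by move=> a; exact: integral_ge0.
Qed.

Lemma integral_refl n (c : 'rV[R]_n) (g : 'rV[R]_n -> \bar R) :
  measurable_fun [set: 'rV[R]_n] g ->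
  (\int[lebesgue_rV R n]_v g (c - v)%R = \int[lebesgue_rV R n]_v g v)%E.
Proof.
move=> mg; rewrite integralE [RHS]integralE.
rewrite -(ge0_integral_refl c (measurable_funepos mg) (@funepos_ge0 _ _ g)).
rewrite -(ge0_integral_refl c (measurable_funeneg mg) (@funeneg_ge0 _ _ g)).
by congr (_ - _)%E; apply: eq_integral => v _; rewrite ?funeposE ?funenegE.
Qed.

Lemma integral_shift n (c : 'rV[R]_n) (g : 'rV[R]_n -> \bar R) :
  measurable_fun [set: 'rV[R]_n] g ->
  (\int[lebesgue_rV R n]_v g (v - c)%R = \int[lebesgue_rV R n]_v g v)%E.
Proof.
move=> mg; rewrite -(integral_refl 0 mg) -(integral_refl c).
  by apply: eq_integral => v _; congr g; rewrite addrAC subrr.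
apply: (measurableT_comp mg (g := fun v : 'rV[R]_n => v - c)).
exact: measurable_rVB.
Qed.

End row_vectors.

(** * Expectations of products of independent factors *)

Section change_of_variables.
Local Open Scope ereal_scope.
Context d3 (S : measurableType d3) (R : realType).

Import HBNNSimple.

Section one_side.
Context d (T : measurableType d) (m : {measure set T -> \bar R}).
Variables (W : T -> R) (X : T -> S).
Hypotheses (mW : measurable_fun [set: T] W) (W0 : forall x, (0 <= W x)%R).
Hypothesis mX : measurable_fun [set: T] X.

Let weighted (g : S -> R) := \int[m]_x (W x * g (X x))%:E.

Let measurable_weighted (g : S -> R) : measurable_fun [set: S] g ->
  measurable_fun [set: T] (fun x => (W x * g (X x))%:E).
Proof.
by move=> mg; apply/measurable_EFinP/measurable_funM => //; exact: measurableT_comp.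
Qed.

Lemma integral_weighted_sfun (s : {nnsfun S >-> R}) :
  weighted s = \sum_(r \in range s) r%:E * weighted (\1_(s @^-1` [set r])).
Proof.
have ge0 r x : (0 <= r * \1_(s @^-1` [set r]) (X x))%R.
  have [r0|r0] := leP 0%R r; first by rewrite mulr_ge0.
  by rewrite preimage_nnfun0// indic0/= mulr0.
rewrite /weighted.
transitivity (\int[m]_x \sum_(r \in range s)
    (W x * (r * \1_(s @^-1` [set r]) (X x)))%:E).
  apply: eq_integral => x _; rewrite fsbig_finite//= sumEFin -mulr_sumr.
  by rewrite {1}fimfunE fsbig_finite.
rewrite ge0_integral_fsum//=; last 2 first.
- move=> r; apply: (@measurable_weighted
    (fun t => r * \1_(s @^-1` [set r]) t)%R).
  by apply: measurable_funM.
- by move=> r x _; rewrite lee_fin mulr_ge0.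
apply: eq_fsbigr => r; rewrite inE => -[t _ <-].
under eq_integral do rewrite mulrCA EFinM.
rewrite ge0_integralZl_EFin//.
- by move=> x _; rewrite lee_fin mulr_ge0.
- by apply: measurable_weighted; exact: measurable_indic.
Qed.

Lemma integral_weighted_lim (g : S -> R) (mg : measurable_fun [set: S] (EFin \o g)) :
  (forall t, 0 <= g t)%R ->
  (weighted (nnsfun_approx measurableT mg k)) @[k --> \oo] --> weighted g.
Proof.
move=> g0; pose u k x := (W x * nnsfun_approx measurableT mg k (X x))%:E.
have -> : weighted g = \int[m]_x limn (u^~ x).
  apply: eq_integral => x _; apply/esym/cvg_lim => //.
  rewrite /u EFinM; under eq_fun do rewrite EFinM.
  apply: cvgeZl => //; apply: (cvg_nnsfun_approx measurableT mg) => // t _.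
  by rewrite /= lee_fin.
apply: cvg_monotone_convergence => //.
- by move=> k; exact: measurable_weighted.
- by move=> k x _; rewrite lee_fin mulr_ge0.
- move=> x _ k l kl; rewrite lee_fin ler_wpM2l//.
  by have /lefP/(_ (X x)) := nd_nnsfun_approx measurableT mg kl.
Qed.

End one_side.

(** By monotone approximation with simple functions.  The weights are needed for
    [expectation_prod], where [W1] is the product of the other independent
    factors and [W2] a multiple of the density. *)
Lemma eq_integral_weighted d1 (T1 : measurableType d1)
    (m1 : {measure set T1 -> \bar R}) (W1 : T1 -> R) (X1 : T1 -> S)
    d2 (T2 : measurableType d2)
    (m2 : {measure set T2 -> \bar R}) (W2 : T2 -> R) (X2 : T2 -> S) (g : S -> R) :
  measurable_fun [set: T1] W1 -> (forall x, 0 <= W1 x)%R ->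
  measurable_fun [set: T1] X1 ->
  measurable_fun [set: T2] W2 -> (forall x, 0 <= W2 x)%R ->
  measurable_fun [set: T2] X2 ->
  (forall A, measurable A ->
    \int[m1]_x (W1 x * \1_A (X1 x))%:E = \int[m2]_x (W2 x * \1_A (X2 x))%:E) ->
  measurable_fun [set: S] g -> (forall t, 0 <= g t)%R ->
  \int[m1]_x (W1 x * g (X1 x))%:E = \int[m2]_x (W2 x * g (X2 x))%:E.
Proof.
move=> mW1 W10 mX1 mW2 W20 mX2 W12 /measurable_EFinP mg g0.
have := integral_weighted_lim (m := m1) mW1 W10 mX1 mg g0.
have := integral_weighted_lim (m := m2) mW2 W20 mX2 mg g0.
rewrite (_ : (fun k => \int[m2]_x _) = (fun k =>
    \int[m1]_x (W1 x * nnsfun_approx measurableT mg k (X1 x))%:E)).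
  by move=> l2 l1; exact: cvg_unique l1 l2.
apply/funext => k; rewrite !integral_weighted_sfun//.
by apply: eq_fsbigr => r _; rewrite W12.
Qed.

End change_of_variables.

Section product_expectation.
Context {R : realType} {d n : nat} {dO : measure_display}
  {Omega : measurableType dO} (P : probability Omega R).
Variables (X : 'I_n -> {RV P >-> 'rV[R]_d}) (f : 'rV[R]_d -> R).
Hypotheses (denf : is_density f) (iidX : iid_with_density X f).
Local Notation leb := (lebesgue_rV R d).
Local Open Scope ereal_scope.

Let mX i : measurable_fun [set: Omega] (X i).
Proof. exact: measurable_funPT. Qed.

Let mf : measurable_fun [set: 'rV[R]_d] f. Proof. by case: denf. Qed.
Let f0 t : (0 <= f t)%R. Proof. by case: denf. Qed.

Let integral_indic_density (A : set 'rV[R]_d) :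
  measurable A -> \int[leb]_t (\1_A t * f t)%:E = \int[leb]_(t in A) (f t)%:E.
Proof.
move=> mA; rewrite [RHS]integral_mkcond; apply: eq_integral => t _.
by rewrite patchE indicE; case: (t \in A); rewrite ?mul1r ?mul0r.
Qed.

(** The factors are released from indicators to general functions one index at
    a time: with the others frozen in the weight, both sides are measures in
    the set carried by the next indicator. *)
Lemma expectation_prod (g : 'I_n -> 'rV[R]_d -> R) :
  (forall i, measurable_fun [set: 'rV[R]_d] (g i)) ->
  (forall i t, 0 <= g i t)%R ->
  (forall i, \int[leb]_t (g i t * f t)%:E < +oo) ->
  \int[P]_w (\prod_i g i (X i w))%:E = \prod_i \int[leb]_t (g i t * f t)%:E.
Proof.
move=> mg g0 goo.
suff H l : (l <= n)%N -> forall g : 'I_n -> 'rV[R]_d -> R,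
    (forall i, measurable_fun [set: 'rV[R]_d] (g i)) ->
    (forall i t, 0 <= g i t)%R ->
    (forall i, \int[leb]_t (g i t * f t)%:E < +oo) ->
    (forall i : 'I_n, (l <= i)%N ->
      exists2 A : set 'rV[R]_d, measurable A & g i = \1_A) ->
  \int[P]_w (\prod_i g i (X i w))%:E = \prod_i \int[leb]_t (g i t * f t)%:E.
  apply: (H n) => // i; by rewrite leqNgt ltn_ord.
elim: l => [_ {mg g0 goo g}g mg g0 goo gA|l IH ln {mg g0 goo g}g mg g0 goo gA].
  have /choice[A AP] i : exists A : set 'rV[R]_d, measurable A /\ g i = \1_A.
    by have [A mA ->] := gA i (leq0n i); exists A.
  have mA i : measurable (A i) by have [] := AP i.
  have := iidX.1 [set: 'I_n]%SET A mA.
  under [X in _ = X -> _]eq_bigr => i _.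
    rewrite -[P _]/(distribution P (X i) (A i)) iidX.2// -integral_indic_density//.
    rewrite -(AP i).2; over.
  rewrite big_mkcond/= (eq_bigr (fun i => \int[leb]_t (g i t * f t)%:E)); last first.
    by move=> i _; rewrite inE.
  move=> <-; set E := \bigcap_(i in _) _.
  have mE : measurable E.
    apply: fin_bigcap_measurable => // i _.
    by rewrite -[X in measurable X]setTI; exact: mX.
  rewrite -[E]setIT -integral_indic//; apply: eq_integral => w _; congr EFin.
  rewrite indicE; have [|] := boolP (w \in E).
    rewrite inE => Ew; rewrite big1// => i _.
    by rewrite (AP i).2 indicE mem_set//; apply: (Ew i); rewrite /= inE.
  rewrite notin_setE => Ew.
  have /existsNP[i /not_implyP[_ nA]] : ~ forall i, i \in [set: 'I_n]%SET -> A i (X i w).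
    by move=> h; apply: Ew => i /= ?; exact: h.
  by rewrite (bigD1 i)//= (AP i).2 indicE memNset// mul0r.
pose i0 := Ordinal ln.
pose W w := (\prod_(i | i != i0) g i (X i w))%R.
pose c := (\prod_(i | i != i0) fine (\int[leb]_t (g i t * f t)%:E))%R.
have I0 (i : 'I_n) : 0 <= \int[leb]_t (g i t * f t)%:E.
  by apply: integral_ge0 => t _; rewrite lee_fin mulr_ge0.
have c0 : (0 <= c)%R by apply: prodr_ge0 => i _; rewrite fine_ge0.
have cE : c%:E = \prod_(i | i != i0) \int[leb]_t (g i t * f t)%:E.
  rewrite /c -prodEFin; apply: eq_bigr => i _; rewrite fineK//.
  by rewrite ge0_fin_numE.
have mcf : measurable_fun [set: 'rV[R]_d] (fun t => (c * f t)%R).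
  exact: measurable_funM.
transitivity (\int[leb]_t (c * f t * g i0 t)%:E); last first.
  rewrite (bigD1 i0)//= -cE muleC -ge0_integralZl_EFin//.
  - by apply: eq_integral => t _; rewrite -EFinM; congr EFin; ring.
  - by move=> t _; rewrite lee_fin mulr_ge0.
  - by apply/measurable_EFinP; exact: measurable_funM.
transitivity (\int[P]_w (W w * g i0 (X i0 w))%:E).
  by apply: eq_integral => w _; rewrite (bigD1 i0)//= mulrC.
apply: (eq_integral_weighted (X2 := id)) => //.
- rewrite /W; under eq_fun do rewrite -big_filter.
  by apply: measurable_prod => i _; exact: measurableT_comp.
- by move=> w; apply: prodr_ge0 => i _.
- by move=> t; rewrite mulr_ge0.
move=> A mA.
pose g' i := if i == i0 then \1_A : 'rV[R]_d -> R else g i.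
have g'E i : i != i0 -> g' i = g i by rewrite /g' => /negbTE ->.
have mg' i : measurable_fun [set: 'rV[R]_d] (g' i).
  by rewrite /g'; case: eqP => // _; exact: measurable_indic.
have := IH (ltnW ln) g' mg'.
have -> : \int[P]_w (\prod_i g' i (X i w))%:E = \int[P]_w (W w * \1_A (X i0 w))%:E.
  apply: eq_integral => w _; rewrite (bigD1 i0)//= {1}/g' eqxx mulrC.
  congr ((_ * _)%:E); apply: eq_bigr => i ii0; by rewrite g'E.
have -> : \prod_i \int[leb]_t (g' i t * f t)%:E = \int[leb]_t (c * f t * \1_A t)%:E.
  rewrite (bigD1 i0)//= {1}/g' eqxx.
  rewrite (eq_bigr (fun i => \int[leb]_t (g i t * f t)%:E)); last first.
    by move=> i ii0; rewrite g'E.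
  rewrite -cE muleC -ge0_integralZl_EFin//.
  - by apply: eq_integral => t _; rewrite -EFinM; congr EFin; ring.
  - by move=> t _; rewrite lee_fin mulr_ge0.
  - by apply/measurable_EFinP/measurable_funM => //; exact: measurable_indic.
apply.
- by move=> i t; rewrite /g'; case: eqP.
- move=> i; rewrite /g'; case: eqP => // _.
  rewrite integral_indic_density//.
  rewrite (@le_lt_trans _ _ (\int[leb]_t (f t)%:E))//; last first.
    by case: denf => _ _ ->; rewrite ltry.
  apply: ge0_subset_integral => //; first exact/measurable_EFinP.
  by move=> t _; rewrite lee_fin.
- move=> i li; rewrite /g'; case: eqP => [_|/eqP ii0]; first by exists A.
  by apply: gA; rewrite ltn_neqAle li andbT eq_sym.
Qed.

End product_expectation.

(** * Elementary bounds on the exponential *)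

Section exponential_bounds.
Variable R : realType.
Implicit Types u s y c : R.

Lemma ge0_of_derivative (g dg : R -> R) c :
  (forall x : R, is_derive x 1 g (dg x)) ->
  (forall x, 0 <= x <= c -> 0 <= dg x) -> 0 <= g 0 ->
  forall y, 0 <= y <= c -> 0 <= g y.
Proof.
move=> gdg dg0 g0 y /andP[y0 yc].
have cg : {within `[0, y], continuous g}.
  apply: continuous_subspaceT => x; apply: differentiable_continuous.
  by apply/derivable1_diffP; case: (gdg x).
have [x] := MVT_segment y0 (fun x _ => gdg x) cg.
rewrite in_itv/= subr0 => /andP[x0 xy] gE.
rewrite -[g y](subrK (g 0)) gE addr_ge0// mulr_ge0// dg0// x0/=.
exact: le_trans xy yc.
Qed.

Lemma expR_chord u s : 0 <= s <= 1 -> expR (s * u) <= 1 - s + s * expR u.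
Proof.
move=> s01; have := @convex_expR R (Itv01 (proj1 (andP s01)) (proj2 (andP s01))) u 0.
by rewrite !convRE/= mulr0 addr0 expR0 mulr1 /unstable.onem addrC.
Qed.

Lemma expR1_le3 : expR 1 <= 3 :> R.
Proof.
have e6 : expR 6^-1 <= 6 / 5 :> R.
  have := expR_ge1Dx (- 6^-1 : R); rewrite expRN => h.
  have : (5 / 6) * expR 6^-1 <= 1 :> R by rewrite -ler_pdivlMr ?expR_gt0//; lra.
  lra.
rewrite (_ : 1 = 6%:R * 6^-1 :> R); last by field.
rewrite expRM_natl (le_trans (lerXn2r 6 _ _ e6)) ?nnegrE ?expR_ge0//; lra.
Qed.

Lemma expR_le_quadratic y : 0 <= y <= 1 -> expR y <= 1 + y + y ^+ 2.
Proof.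
move=> y01; rewrite -subr_ge0.
pose g (x : R) := 1 + x + x ^+ 2 - expR x.
have dg (x : R) : is_derive x 1 g (1 + 2 * x - expR x).
  by apply: is_derive_eq; rewrite /= !scaler1 /GRing.scale/=; ring.
apply: (ge0_of_derivative dg _ _ y01) => [x /andP[x0 x1]|].
  have := @expR_chord 1 x; rewrite mulr1 x0 x1 => /(_ isT) h.
  have := expR1_le3; nra.
by rewrite /g expR0; lra.
Qed.

(** The coefficient of the cube is chosen so that the cubic terms in
    [bernstein_exponent] cancel. *)
Lemma expR_le_cubic y : 0 <= y <= 1 -> expR y <= 1 + y + y ^+ 2 / 2 + y ^+ 3.
Proof.
move=> y01; rewrite -subr_ge0.
pose g (x : R) := 1 + x + x ^+ 2 / 2 + x ^+ 3 - expR x.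
have dg (x : R) : is_derive x 1 g (1 + x + 3 * x ^+ 2 - expR x).
  by apply: is_derive_eq; rewrite /= !scaler1 /GRing.scale/=; field.
apply: (ge0_of_derivative dg _ _ y01) => [x x01|].
  have := expR_le_quadratic x01; nra.
by rewrite /g expR0; lra.
Qed.

Lemma sinh_ge u : 0 <= u -> 2 * u <= expR u - expR (- u).
Proof.
move=> u0; rewrite -subr_ge0.
pose g (x : R) := expR x - expR (- x) - 2 * x.
have dg (x : R) : is_derive x 1 g (expR x + expR (- x) - 2).
  by apply: is_derive_eq; rewrite /= ?scaler1 /GRing.scale/=; ring.
apply: (@ge0_of_derivative g _ u dg) => [x _||].
- have := expR_ge1Dx x; have := expR_ge1Dx (- x); lra.
- by rewrite /g oppr0 expR0; lra.
- by rewrite u0 lexx.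
Qed.

(** Bernstein's bound for one variable in [-1, 1], with [`|s|] in the place of
    the usual square: the variance of a kernel enters only through the
    first absolute moment of that kernel, which is what the majorants are made of. *)
Lemma expR_le_abs u s : 0 <= u -> `|s| <= 1 ->
  expR (u * s) <= 1 + u * s + `|s| * (expR u - 1 - u).
Proof.
move=> u0 s1; rewrite mulrC.
have [s0|s0] := leP 0 s.
  rewrite ger0_norm// in s1 *.
  have := @expR_chord u s; rewrite s0 s1 => /(_ isT); lra.
rewrite ltr0_norm// in s1 *.
have := @expR_chord (- u) (- s); rewrite mulrNN oppr_ge0 ltW// s1 => /(_ isT).
have := sinh_ge u0; nra.
Qed.

Lemma expR_sub1_le y : expR y - 1 <= y * expR y.
Proof.
have := expR_ge1Dx (- y); rewrite expRN => h.
have e0 := expR_gt0 y.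
have : (1 - y) * expR y <= 1 by rewrite -ler_pdivlMr// div1r.
lra.
Qed.

(** The optimized exponent: [r] and [l] are the square roots of the first moment
    and of the noise level, and the exponent is evaluated at [u = min(l / r, 1)]. *)
Lemma bernstein_exponent (r l : R) : 0 < r -> 0 < l ->
  exists2 u, 0 < u & r ^+ 2 * (expR u - 1 - u) - u * (r * l + l ^+ 2) <= - (l ^+ 2 / 2).
Proof.
move=> r0 l0; have [lr|rl] := leP l r.
  exists (l / r); first by rewrite divr_gt0.
  have u01 : 0 <= l / r <= 1.
    by rewrite divr_ge0 ?(ltW r0) ?(ltW l0)//= ler_pdivrMr// mul1r.
  have := expR_le_cubic u01 => h.
  have : r ^+ 2 * (expR (l / r) - 1 - l / r) <=
         r ^+ 2 * ((l / r) ^+ 2 / 2 + (l / r) ^+ 3).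
    by rewrite ler_wpM2l ?sqr_ge0//; lra.
  have -> : r ^+ 2 * ((l / r) ^+ 2 / 2 + (l / r) ^+ 3) =
            l ^+ 2 / 2 + l ^+ 3 / r by field; rewrite gt_eqF.
  have -> : l / r * (r * l + l ^+ 2) = l ^+ 2 + l ^+ 3 / r.
    by field; rewrite gt_eqF.
  lra.
exists 1 => //; have := expR1_le3; nra.
Qed.

End exponential_bounds.

(** * Integrals against a density *)

Section density_integrals.
Variables (R : realType) (d : nat) (f : 'rV[R]_d -> R).
Hypothesis denf : is_density f.
Local Notation leb := (@lebesgue_rV R d).

Let mf : measurable_fun [set: 'rV[R]_d] f. Proof. by case: denf. Qed.
Let f0 t : 0 <= f t. Proof. by case: denf. Qed.

Lemma integrable_density : leb.-integrable setT (EFin \o f).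
Proof.
apply/integrableP; split; first exact/measurable_EFinP.
under eq_integral do rewrite /= ger0_norm//.
by case: denf => _ _ ->; rewrite ltry.
Qed.

Lemma integrable_mul_density (g : 'rV[R]_d -> R) (b : R) :
  measurable_fun [set: 'rV[R]_d] g -> (forall t, `|g t| <= b) ->
  leb.-integrable setT (EFin \o (fun t => g t * f t)).
Proof.
move=> mg gb; rewrite (_ : _ \o _ = (EFin \o f) \* (EFin \o g))%E; last first.
  by apply/funext => t /=; rewrite -EFinM mulrC.
apply: integrableMl => //; first exact: integrable_density.
exists b; split; first exact: num_real.
by move=> x bx t _; apply: le_trans (gb t) (ltW bx).
Qed.

Lemma Rintegral_density : \int[leb]_t f t = 1.
Proof. by rewrite /Rintegral; case: denf => _ _ ->. Qed.

Lemma EFin_Rintegral (g : 'rV[R]_d -> R) :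
  leb.-integrable setT (EFin \o g) ->
  (\int[leb]_t (g t)%:E = (\int[leb]_t g t)%:E)%E.
Proof. by move=> ig; rewrite /Rintegral fineK//; exact: integrable_fin_num. Qed.

End density_integrals.

(** * Deviations of an empirical mean *)

Section deviations.
Context {R : realType} {d n : nat} {dO : measure_display}
  {Omega : measurableType dO} (P : probability Omega R).
Variables (X : 'I_n -> {RV P >-> 'rV[R]_d}) (f : 'rV[R]_d -> R).
Hypotheses (denf : is_density f) (iidX : iid_with_density X f).
Hypothesis n_gt0 : (0 < n)%N.
Local Notation leb := (lebesgue_rV R d).

Let mX i : measurable_fun [set: Omega] (X i).
Proof. exact: measurable_funPT. Qed.
Let mf : measurable_fun [set: 'rV[R]_d] f. Proof. by case: denf. Qed.
Let f0 t : 0 <= f t. Proof. by case: denf. Qed.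

Let n0 : 0 < n%:R :> R. Proof. by rewrite ltr0n. Qed.

(** The additive constant is there for Markov's inequality with [expR - 1] in the
    place of [expR]. *)
Lemma markov_affine (S : set Omega) (G : Omega -> R) (c1 c0 : R) :
  measurable S -> measurable_fun [set: Omega] G -> 0 <= c1 -> 0 <= c0 ->
  (forall w, c1 * \1_S w + c0 <= G w) ->
  ((c1 * fine (P S) + c0)%:E <= \int[P]_w (G w)%:E)%E.
Proof.
move=> mS mG c10 c00 SG.
have -> : ((c1 * fine (P S) + c0)%:E = \int[P]_w (c1 * \1_S w + c0)%:E)%E.
  under eq_integral do rewrite EFinD EFinM.
  rewrite ge0_integralD//=; last 2 first.
  - by move=> w _; rewrite lee_fin mulr_ge0.
  - by apply/measurable_EFinP/measurable_funM => //; exact: measurable_indic.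
  rewrite ge0_integralZl_EFin//=; last first.
    by apply/measurable_EFinP; exact: measurable_indic.
  rewrite integral_indic// setIT integral_cst//.
  rewrite [X in (_ = _ + c0%:E * X)%E](_ : _ = 1%E); last exact: probability_setT.
  by rewrite mule1 EFinD EFinM fineK// fin_num_measure.
apply: ge0_le_integral => //.
- by move=> w _; rewrite lee_fin addr_ge0// mulr_ge0.
- by apply/measurable_EFinP/measurable_funD => //; apply: measurable_funM => //;
    exact: measurable_indic.
- exact/measurable_EFinP.
- by move=> w _; rewrite lee_fin.
Qed.

Section statistic.
Variables (phi : 'rV[R]_d -> R) (b a : R).
Hypotheses (mphi : measurable_fun [set: 'rV[R]_d] phi) (b_gt0 : 0 < b)
  (phib : forall t, `|phi t| <= b) (phia : \int[leb]_t (`|phi t| * f t) <= a).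

Let mabs : measurable_fun [set: 'rV[R]_d] (fun t => `|phi t|).
Proof. exact: measurableT_comp. Qed.

Let abs_phib t : `| `|phi t| | <= b. Proof. by rewrite normr_id. Qed.

(** Both terms of the exponent are at most proportional to [a]; the gain in
    [deviation_prob] rests on this. *)
Lemma laplace_density u : 0 <= u ->
  (\int[leb]_t (expR (u * (phi t / b)) * f t)%:E <=
   (expR (u / b * (\int[leb]_t (phi t * f t)) + a / b * (expR u - 1 - u)))%:E)%E.
Proof.
move=> u0; set psi := expR u - 1 - u.
have psi0 : 0 <= psi by rewrite /psi; have := expR_ge1Dx u; lra.
pose g t := f t + (u / b * (phi t * f t) + psi / b * (`|phi t| * f t)).
have i1 := integrable_mul_density denf mphi phib.
have i2 := integrable_mul_density denf mabs abs_phib.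
have i3 : leb.-integrable setT
    (EFin \o (fun t => u / b * (phi t * f t) + psi / b * (`|phi t| * f t))).
  have := integrableD measurableT (integrableZl measurableT (u / b) i1)
    (integrableZl measurableT (psi / b) i2).
  by apply: eq_integrable.
apply: (@le_trans _ _ (\int[leb]_t (g t)%:E)%E).
  apply: le_nonneg_integral => t; first by rewrite lee_fin mulr_ge0 ?expR_ge0.
  rewrite lee_fin /g.
  have pb : `|phi t / b| <= 1.
    by rewrite normrM normfV (gtr0_norm b_gt0) ler_pdivrMr// mul1r.
  have := expR_le_abs u0 pb; rewrite normrM normfV (gtr0_norm b_gt0) -/psi => h.
  have -> : f t + (u / b * (phi t * f t) + psi / b * (`|phi t| * f t)) =
    (1 + u * (phi t / b) + `|phi t| / b * psi) * f t by ring.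
  by rewrite ler_wpM2r.
have ig : leb.-integrable setT (EFin \o g).
  have := integrableD measurableT (integrable_density denf) i3.
  by apply: eq_integrable.
rewrite EFin_Rintegral// lee_fin /g RintegralD//; last exact: integrable_density.
rewrite RintegralD//; last 2 first.
- by have := integrableZl measurableT (u / b) i1; apply: eq_integrable.
- by have := integrableZl measurableT (psi / b) i2; apply: eq_integrable.
rewrite !RintegralZl// Rintegral_density//.
apply: le_trans (expR_ge1Dx _); rewrite lerD2l lerD2l.
rewrite (_ : a / b * psi = psi / b * a); last by ring.
by rewrite ler_wpM2l// divr_ge0// ltW.
Qed.

Lemma laplace_sum u : 0 <= u ->
  (\int[P]_w (expR (u / b * \sum_i phi (X i w)))%:E <=
   (expR (n%:R * (u / b * (\int[leb]_t (phi t * f t)) +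
      a / b * (expR u - 1 - u))))%:E)%E.
Proof.
move=> u0; pose g (i : 'I_n) t := expR (u * (phi t / b)).
have mg i : measurable_fun [set: 'rV[R]_d] (g i).
  apply: measurableT_comp; first exact: measurable_expR.
  by apply: measurable_funM => //; exact: measurable_funM.
have gE := laplace_density u0.
rewrite (_ : (\int[P]_w _)%E = (\int[P]_w (\prod_i g i (X i w))%:E)%E); last first.
  apply: eq_integral => w _; rewrite /g -expR_sum; congr (expR _)%:E.
  by rewrite mulr_sumr; apply: eq_bigr => i _; ring.
rewrite (expectation_prod denf iidX) //; last 2 first.
- by move=> i t; exact: expR_ge0.
- by move=> i; apply: le_lt_trans gE _; rewrite ltry.
apply: (@le_trans _ _ (\prod_(i < n) (expR (u / b * (\int[leb]_t (phi t * f t)) +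
    a / b * (expR u - 1 - u)))%:E)%E).
  apply: lee_prod => i; rewrite gE andbT.
  by apply: integral_ge0 => t _; rewrite lee_fin mulr_ge0 ?expR_ge0.
by rewrite prodEFin prodr_const card_ord expRM_natl.
Qed.

Lemma measurable_sum_sample :
  measurable_fun [set: Omega] (fun w => \sum_i phi (X i w)).
Proof. by apply: measurable_sum => i; exact: measurableT_comp. Qed.

Lemma measurable_sum_gt (z : R) : measurable [set w | z < \sum_i phi (X i w)].
Proof.
rewrite (_ : [set w | _] =
    (fun w => \sum_i phi (X i w)) @^-1` `]z, +oo[%classic).
  by rewrite -[X in measurable X]setTI; exact: measurable_sum_sample.
by apply/seteqP; split => w /=; rewrite in_itv/= andbT.
Qed.

Let measurable_exp_sum u :
  measurable_fun [set: Omega] (fun w => expR (u / b * \sum_i phi (X i w))).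
Proof.
apply: measurableT_comp; first exact: measurable_expR.
by apply: measurable_funM => //; exact: measurable_sum_sample.
Qed.

Lemma chernoff_sum u z : 0 <= u ->
  fine (P [set w | n%:R * ((\int[leb]_t (phi t * f t)) + z) < \sum_i phi (X i w)])
  <= expR (n%:R / b * (a * (expR u - 1 - u) - u * z)).
Proof.
move=> u0; set m := (\int[leb]_t (phi t * f t)); set S := [set w | _].
have mS : measurable S by exact: measurable_sum_gt.
have SG w : expR (u / b * (n%:R * (m + z))) * \1_S w + 0 <=
    expR (u / b * \sum_i phi (X i w)).
  rewrite addr0 indicE; have [|_] := boolP (w \in S); last by rewrite mulr0 expR_ge0.
  rewrite inE /S/= mulr1 ler_expR => Sw; rewrite ler_wpM2l ?(ltW Sw)//.
  exact: divr_ge0 u0 (ltW b_gt0).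
have := markov_affine mS (measurable_exp_sum u) (expR_ge0 _) (lexx _) SG.
move=> /le_trans/(_ (laplace_sum u0)).
rewrite lee_fin addr0 mulrC -ler_pdivlMr ?expR_gt0// -expRB => /le_trans; apply.
rewrite ler_expR -/m le_eqVlt; apply/orP; left; apply/eqP; field.
by rewrite gt_eqF.
Qed.

End statistic.

Lemma measurable_deviation (phi : 'rV[R]_d -> R) (m z : R) :
  measurable_fun [set: 'rV[R]_d] phi ->
  measurable [set w | z < `|n%:R^-1 * (\sum_i phi (X i w)) - m|].
Proof.
move=> mphi.
rewrite (_ : [set w | _] = (fun w => `|n%:R^-1 * (\sum_i phi (X i w)) - m|)
    @^-1` `]z, +oo[%classic).
  rewrite -[X in measurable X]setTI.
  suff : measurable_fun [set: Omega]
    (fun w => `|n%:R^-1 * (\sum_i phi (X i w)) - m|) by apply.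
  apply: measurableT_comp => //; apply: measurable_funB => //.
  by apply: measurable_funM => //; exact: measurable_sum_sample.
by apply/seteqP; split => w /=; rewrite in_itv/= andbT.
Qed.

(** Bernstein's inequality with the extra factor [n * a / b], which is what makes
    the bound integrable over the estimation point.  If [n * a >= b] that factor
    is at least one and the classical inequality suffices.  If [n * a < b] few
    observations are seen by [phi]: the noise level exceeds [a], so that
    a deviation forces [\sum_i |phi (X i)|] above [n * lam], and Markov's inequality
    applied to its Laplace transform minus one retains the factor [a]. *)
Lemma deviation_prob (phi : 'rV[R]_d -> R) (b a lam : R) :
  measurable_fun [set: 'rV[R]_d] phi -> 0 < b ->
  (forall t, `|phi t| <= b) -> \int[leb]_t (`|phi t| * f t) <= a ->
  b <= n%:R * lam ->
  fine (P [set w | Num.sqrt (a * lam) + lam <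
    `|n%:R^-1 * (\sum_i phi (X i w)) - \int[leb]_t (phi t * f t)| ])
  <= 36 * (n%:R * a / b) * expR (- (n%:R * lam / (2 * b))).
Proof.
move=> mphi b0 phib phia blam.
set m := \int[leb]_t (phi t * f t); set z := Num.sqrt _ + lam.
set S := [set w | _].
have mabs : measurable_fun [set: 'rV[R]_d] (fun t => `|phi t|).
  exact: measurableT_comp.
have a0 : 0 <= a.
  by apply: le_trans phia; apply: Rintegral_ge0 => t _; rewrite mulr_ge0.
have lam0 : 0 < lam.
  by rewrite -(pmulr_rgt0 _ n0); exact: lt_le_trans blam.
have mS : measurable S by exact: measurable_deviation.
have e0 (x : R) := expR_gt0 x.
have [ban|nab] := leP b (n%:R * a).
  have a_gt0 : 0 < a by rewrite -(pmulr_rgt0 _ n0); exact: lt_le_trans ban.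
  have r0 : 0 < Num.sqrt a by rewrite sqrtr_gt0.
  have l0 : 0 < Num.sqrt lam by rewrite sqrtr_gt0.
  have [u u0] := bernstein_exponent r0 l0.
  have zE : Num.sqrt a * Num.sqrt lam + Num.sqrt lam ^+ 2 = z.
    by rewrite /z sqrtrM// sqr_sqrtr// ltW.
  rewrite zE (sqr_sqrtr a0) (sqr_sqrtr (ltW lam0)) => uz.
  pose Sp := [set w | n%:R * (m + z) < \sum_i phi (X i w)].
  pose Sm := [set w | n%:R * ((\int[leb]_t (- phi t * f t)) + z) <
                      \sum_i - phi (X i w)].
  have mphiN : measurable_fun [set: 'rV[R]_d] (fun t => - phi t).
    exact: measurableT_comp.
  have mE : \int[leb]_t (- phi t * f t) = - m.
    rewrite -mulN1r -RintegralZl//.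
      by apply: eq_Rintegral => t _; rewrite mulN1r mulNr.
    exact: integrable_mul_density phib.
  have mSp : measurable Sp by exact: measurable_sum_gt.
  have mSm : measurable Sm by exact: (measurable_sum_gt mphiN).
  have SS : S `<=` Sp `|` Sm.
    move=> w; rewrite /S/= lter_normr => /orP[h|h]; [left|right]; rewrite /= ?/Sp ?/Sm /=.
      have := ltr_pM2l n0 (m + z) (n%:R^-1 * \sum_i phi (X i w)).
      rewrite mulrA divff ?gt_eqF// mul1r => ->; lra.
    rewrite mE sumrN.
    have := ltr_pM2l n0 (- m + z) (- (n%:R^-1 * \sum_i phi (X i w))).
    rewrite mulrN mulrA divff ?gt_eqF// mul1r => ->; lra.
  have PSS : fine (P S) <= fine (P Sp) + fine (P Sm).
    rewrite -fineD ?fin_num_measure// fine_le ?fin_numD ?fin_num_measure//.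
    apply: le_trans (measureU2 P mSp mSm).
    by apply: le_measure; rewrite ?inE//; exact: measurableU.
  have hp := chernoff_sum mphi b0 phib phia z (ltW u0).
  have hm : fine (P Sm) <= expR (n%:R / b * (a * (expR u - 1 - u) - u * z)).
    apply: chernoff_sum => //; last exact: ltW.
      by move=> t; rewrite normrN.
    by under eq_Rintegral do rewrite normrN.
  have eE : expR (n%:R / b * (a * (expR u - 1 - u) - u * z)) <=
            expR (- (n%:R * lam / (2 * b))).
    rewrite ler_expR (_ : - (n%:R * lam / (2 * b)) = n%:R / b * (- (lam / 2))); last first.
      by field; rewrite gt_eqF.
    by rewrite ler_wpM2l// divr_ge0// ltW.
  have nab1 : 1 <= n%:R * a / b by rewrite ler_pdivlMr// mul1r.
  have := e0 (- (n%:R * lam / (2 * b))).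
  rewrite -/m -/Sp in hp; nra.
have alam : a <= lam.
  by rewrite -(ler_pM2l n0) (le_trans (ltW nab)).
have aphib t : `| `|phi t| | <= b by rewrite normr_id.
have aphia : \int[leb]_t (`| `|phi t| | * f t) <= a.
  by under eq_Rintegral do rewrite normr_id.
pose S' := [set w | n%:R * lam < \sum_i `|phi (X i w)|].
have mS' : measurable S' by exact: (measurable_sum_gt mabs).
have SS' : S `<=` S'.
  move=> w; rewrite /S/S'/= => zw.
  have mle : `|m| <= a.
    apply: le_trans phia; rewrite /m.
    apply: le_trans (le_normr_Rintegral _ _) _ => //.
      exact: integrable_mul_density phib.
    rewrite le_eqVlt; apply/orP; left; apply/eqP.
    by apply: eq_Rintegral => t _; rewrite normrM (ger0_norm (f0 t)).
  have az : a + lam <= z.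
    rewrite lerD2r -[leLHS](sqr_sqrtr a0) expr2 sqrtrM//.
    by rewrite ler_wpM2l ?sqrtr_ge0// ler_sqrt// ltW.
  have := le_lt_trans az (lt_le_trans zw (ler_normB _ _)).
  rewrite normrM normfV (gtr0_norm n0) => h.
  have : lam < n%:R^-1 * `|\sum_i phi (X i w)| by lra.
  rewrite mulrC ltr_pdivlMr// mulrC => /lt_le_trans; apply.
  exact: ler_norm_sum.
have PSS' : fine (P S) <= fine (P S').
  by rewrite fine_le ?fin_num_measure// le_measure ?inE.
apply: (le_trans PSS').
have blam1 : 1 <= n%:R * lam / b by rewrite ler_pdivlMr// mul1r.
set E := expR (n%:R * lam / b).
have E2 : 2 <= E by have := expR_ge1Dx (n%:R * lam / b); rewrite -/E; lra.
have SG w : (E - 1) * \1_S' w + 1 <= expR (1 / b * \sum_i `|phi (X i w)|).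
  rewrite indicE; have [|_] := boolP (w \in S').
    rewrite inE /S'/= mulr1 subrK => Sw.
    by rewrite ler_expR div1r mulrC ler_wpM2l ?invr_ge0 ?(ltW b0)// ltW.
  rewrite mulr0 add0r -expR0 ler_expR mulr_ge0 ?divr_ge0 ?(ltW b0)//.
  by apply: sumr_ge0.
have E1 : 0 <= E - 1 by lra.
have mG : measurable_fun [set: Omega]
    (fun w => expR (1 / b * \sum_i `|phi (X i w)|)).
  apply: measurableT_comp; first exact: measurable_expR.
  by apply: measurable_funM => //; exact: (measurable_sum_sample mabs).
have := markov_affine mS' mG E1 ler01 SG.
move=> /le_trans/(_ (laplace_sum mabs b0 aphib aphia ler01)).
rewrite lee_fin => H.
set v := n%:R * a / b in H *.
have v0 : 0 <= v by rewrite divr_ge0 ?mulr_ge0// ltW.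
have v1 : v <= 1 by rewrite ler_pdivrMr// mul1r ltW.
have H2 : (E - 1) * fine (P S') + 1 <= expR (2 * v).
  apply: (le_trans H); rewrite ler_expR.
  have A0 : 0 <= \int[leb]_t (`|phi t| * f t).
    by apply: Rintegral_ge0 => t _; rewrite mulr_ge0.
  have nb : 0 <= n%:R / b by rewrite divr_ge0// ltW.
  have -> : n%:R * (1 / b * (\int[leb]_t (`|phi t| * f t)) +
      a / b * (expR 1 - 1 - 1)) =
    n%:R / b * (\int[leb]_t (`|phi t| * f t)) + v * (expR 1 - 1 - 1).
    by rewrite /v; ring.
  have : n%:R / b * (\int[leb]_t (`|phi t| * f t)) <= v.
    by rewrite /v [leRHS]mulrAC ler_wpM2l.
  have := expR1_le3 R; nra.
have e9 : expR (2 * v) <= 9.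
  apply: (@le_trans _ _ (expR (2%:R * 1))); first by rewrite ler_expR; lra.
  rewrite expRM_natl; have := expR1_le3 R; have := e0 1; nra.
(* [18 = 2 * 9], and 36 results from [E - 1 >= E / 2]. *)
have H3 : (E - 1) * fine (P S') <= 18 * v.
  have := expR_sub1_le (2 * v); have := e0 (2 * v); nra.
have p0 : 0 <= fine (P S') by rewrite fine_ge0.
have H4 : fine (P S') <= 36 * v * E^-1.
  rewrite ler_pdivlMr; last by lra.
  nra.
apply: (le_trans H4).
rewrite /E -expRN; apply: ler_wpM2l; first exact: mulr_ge0.
rewrite ler_expR lerN2.
rewrite (_ : n%:R * lam / (2 * b) = n%:R * lam / b / 2); first lra.
by field; rewrite gt_eqF.
Qed.

End deviations.

(** * Finite suprema and dyadic bandwidths *)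

Section finite_sup.
Variable R : realType.

Lemma finite_set_max (S : set R) : finite_set S -> S !=set0 ->
  exists2 m, S m & forall y, S y -> y <= m.
Proof.
move=> /finite_seqP[s ->]; elim: s => [[x]|x s IH _]; first by rewrite /= in_nil.
have [->|s0] := eqVneq s [::].
  by exists x => [|y]; rewrite /= !inE// => /eqP ->.
have [y ys] : [set` s] !=set0.
  by case: s s0 {IH} => // y s _; exists y; rewrite /= mem_head.
have [m ms mmax] := IH (ex_intro _ y ys).
exists (Num.max x m) => [|z] /=.
  by rewrite inE; case: leP => _; rewrite ?eqxx// [m \in s]ms orbT.
by rewrite inE le_max => /orP[/eqP ->|/mmax ->]; rewrite ?lexx ?orbT.
Qed.

Section image.
Variables (T : Type) (A : set T) (F : T -> R).
Hypothesis finA : finite_set A.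

Lemma fin_sup_ge x : A x -> F x <= sup [set F y | y in A].
Proof.
move=> Ax; apply: ub_le_sup; last by exists x.
have [m _ mmax] : exists2 m, (F @` A) m & forall y, (F @` A) y -> y <= m.
  by apply: finite_set_max; [exact: finite_image|exists (F x), x].
by exists m.
Qed.

Lemma fin_sup_in x : A x -> exists2 y, A y & sup [set F y | y in A] = F y.
Proof.
move=> Ax.
have [_ [y Ay <-] ymax] : exists2 m, (F @` A) m & forall y, (F @` A) y -> y <= m.
  by apply: finite_set_max; [exact: finite_image|exists (F x), x].
exists y => //; apply/eqP; rewrite eq_le fin_sup_ge// andbT.
by apply: ge_sup => //; exists (F x), x.
Qed.

End image.

Lemma fin_inf_in (T : Type) (A : set T) (F : T -> R) x : finite_set A -> A x ->
  exists2 y, A y & inf [set F y | y in A] = F y.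
Proof.
move=> finA Ax; rewrite /inf.
rewrite (_ : [set - y | y in _] = [set - F y | y in A]); last first.
  by rewrite image_comp.
have [y Ay ->] := fin_sup_in (fun x => - F x) finA Ax.
by exists y => //; rewrite opprK.
Qed.

End finite_sup.

Section bandwidth_grid.
Variables (R : realType) (d n : nat).
Implicit Types h eta t x : 'rV[R]_d.
Local Notation H := (@bandwidths R d n).
Local Notation grid := {ffun 'I_d -> 'I_(trunc_log 2 n).+1}.

Definition bandwidth_of (k : grid) : 'rV[R]_d := \row_j 2^-1 ^+ k j.

Lemma bandwidthsE : H = range bandwidth_of.
Proof.
apply/seteqP; split => [h Hh|_ [k _ <-] j]; last first.
  by exists (k j) => //; rewrite ?mxE// -ltnS.
have /choice[k kP] j : exists k : 'I_(trunc_log 2 n).+1, h ord0 j = 2^-1 ^+ k.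
  by have [k kn ->] := Hh j; rewrite -ltnS in kn; exists (Ordinal kn).
by exists (finfun k) => //; apply/rowP => j; rewrite mxE ffunE.
Qed.

Lemma bandwidths_finite : finite_set H.
Proof. by rewrite bandwidthsE; exact: finite_image. Qed.

Lemma card_grid_le : (0 < n)%N -> (#|{: grid}| <= n ^ d)%N.
Proof.
move=> n0; rewrite card_ffun !card_ord.
have [->|d0] := posnP d; first by rewrite !expn0.
rewrite leq_exp2r//.
have := trunc_log_bounds (isT : (1 < 2)%N) n0 => /andP[+ _]; apply: leq_trans.
exact: ltn_expl.
Qed.

Lemma bandwidth_one : H (const_mx 1).
Proof. by move=> j; exists 0%N; rewrite ?mxE. Qed.

Lemma bandwidth_gt0 h j : H h -> 0 < h ord0 j.
Proof. by move=> /(_ j)[k _ ->]; rewrite exprn_gt0. Qed.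

Lemma bandwidth_le1 h j : H h -> h ord0 j <= 1.
Proof. by move=> /(_ j)[k _ ->]; rewrite exprn_ile1 ?invr_ge0// invf_le1// ler1n. Qed.

Lemma vol_gt0 h : H h -> 0 < vol h.
Proof. by move=> Hh; apply: prodr_gt0 => j _; exact: bandwidth_gt0. Qed.

Lemma invr_vol_le h : (0 < n)%N -> H h -> (vol h)^-1 <= n%:R ^+ d.
Proof.
move=> n0 Hh; rewrite -prodfV -[d in leRHS]card_ord -prodr_const.
apply: ler_prod => j _; rewrite invr_ge0 ltW ?(bandwidth_gt0 j Hh)//=.
have [k kn ->] := Hh j; rewrite -exprVn invrK -natrX ler_nat.
have := trunc_log_bounds (isT : (1 < 2)%N) n0 => /andP[+ _]; apply: leq_trans.
by rewrite leq_exp2l.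
Qed.

Lemma max_bandwidth h eta : H h -> H eta -> H (max_rV h eta).
Proof.
move=> Hh He j; rewrite mxE; have [k kn ->] := Hh j; have [l ln ->] := He j.
by case: leP => _; [exists l|exists k].
Qed.

Lemma le_max_rVl h eta : le_rV h (max_rV h eta).
Proof. by move=> j; rewrite mxE le_max lexx. Qed.

Lemma max_rVC h eta : max_rV h eta = max_rV eta h.
Proof. by apply/rowP => j; rewrite !mxE maxC. Qed.

End bandwidth_grid.

(** * The kernels and their convolutions *)

Section rescaling.
Variables (R : realType) (d : nat).
Implicit Types (h t x : 'rV[R]_d) (g : 'rV[R]_d -> R) (B c : R).

Lemma measurable_map_rV (u : 'I_d -> R -> R) :
  (forall j, measurable_fun [set: R] (u j)) ->
  measurable_fun [set: 'rV[R]_d] (fun t => \row_j u j (t ord0 j) : 'rV[R]_d).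
Proof.
move=> mu; apply: measurable_fun_rV => j; under eq_fun do rewrite mxE.
by apply: measurableT_comp => //; exact: measurable_coord.
Qed.

Lemma measurable_rescale g h : measurable_fun [set: 'rV[R]_d] g ->
  measurable_fun [set: 'rV[R]_d] (rescale g h).
Proof.
move=> mg; apply: measurable_funM => //.
apply: (measurableT_comp mg (g := fun t : 'rV[R]_d => div_rV t h)).
rewrite (_ : (fun _ => _) = fun t => \row_j (t ord0 j / h ord0 j)); last first.
  by apply/funext => t; apply/rowP => j; rewrite !mxE.
by apply: (measurable_map_rV (u := fun j a => a / h ord0 j)) => j;
  exact: measurable_funM.
Qed.

Lemma measurable_shift g x : measurable_fun [set: 'rV[R]_d] g ->
  measurable_fun [set: 'rV[R]_d] (fun t => g (t - x)).
Proof.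
move=> mg; apply: (measurableT_comp mg (g := fun t : 'rV[R]_d => t - x)).
exact: measurable_rVB.
Qed.

Lemma rescale_bound g h B t : 0 < vol h -> (forall u, `|g u| <= B) ->
  `|rescale g h t| <= B / vol h.
Proof.
move=> h0 gB; rewrite normrM normfV (gtr0_norm h0) mulrC.
by rewrite ler_wpM2r ?invr_ge0 ?(ltW h0).
Qed.

Lemma rescale_supp g h c t : (forall j, 0 < h ord0 j) ->
  (forall u : 'rV[R]_d, (exists j, c < `|u ord0 j|) -> g u = 0) ->
  (exists j, c * h ord0 j < `|t ord0 j|) -> rescale g h t = 0.
Proof.
move=> h0 gc [j jt]; rewrite /rescale gc ?mulr0//; exists j.
by rewrite mxE normrM normfV (gtr0_norm (h0 j)) ltr_pdivlMr.
Qed.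

End rescaling.

Section kernel.
Variables (R : realType) (d : nat) (K : 'rV[R]_d -> R).
Hypothesis kerK : is_kernel K.
Local Notation leb := (@lebesgue_rV R d).
Implicit Types (h eta t x y : 'rV[R]_d) (n : nat).

Lemma measurable_kernel : measurable_fun [set: 'rV[R]_d] K.
Proof. by apply: continuous_measurable_rV; case: kerK. Qed.

Lemma kernel_le t : `|K t| <= supnorm K.
Proof. by case: kerK => _ _ _ ub; apply: ub_le_sup => //; exists t. Qed.

Lemma supnorm_ge0 : 0 <= supnorm K.
Proof. exact: le_trans (normr_ge0 _) (kernel_le 0). Qed.

Lemma measurable_conv_integrand h eta :
  measurable_fun [set: 'rV[R]_d * 'rV[R]_d]
    (fun p => rescale K h (p.1 - p.2) * rescale K eta p.2).
Proof.
apply: measurable_funM.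
  apply: measurableT_comp; first exact: measurable_rescale measurable_kernel.
  exact: measurable_rVB.
by apply: measurableT_comp => //; exact: measurable_rescale measurable_kernel.
Qed.

Lemma measurable_conv_integrand2 h eta t :
  measurable_fun [set: 'rV[R]_d]
    (fun y => rescale K h (t - y) * rescale K eta y).
Proof.
apply: (measurableT_comp (measurable_conv_integrand h eta)
  (g := fun y : 'rV[R]_d => (t, y))).
exact: measurable_fun_pair.
Qed.

Lemma measurable_conv2 h eta : measurable_fun [set: 'rV[R]_d] (conv2 K h eta).
Proof.
have mI := measurable_conv_integrand h eta.
have mE : measurable_fun [set: 'rV[R]_d * 'rV[R]_d]
    (fun p => (rescale K h (p.1 - p.2) * rescale K eta p.2)%:E).
  exact/measurable_EFinP.
rewrite /conv2 /Rintegral.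
apply: (measurableT_comp (fine_measurable measurableT)).
rewrite (_ : (fun _ => _) = fun t => (fubini_F leb
    (fun p => (rescale K h (p.1 - p.2) * rescale K eta p.2)%:E)^\+%E t -
  fubini_F leb
    (fun p => (rescale K h (p.1 - p.2) * rescale K eta p.2)%:E)^\-%E t)%E).
  apply: emeasurable_funB; apply: measurable_fun_fubini_tonelli_F => //.
    exact: measurable_funepos.
  exact: measurable_funeneg.
apply/funext => t; rewrite integralE; congr (_ - _)%E; apply: eq_integral => y _;
  by rewrite ?funeposE ?funenegE.
Qed.

Lemma conv2C h eta t : conv2 K h eta t = conv2 K eta h t.
Proof.
rewrite /conv2 /Rintegral; congr fine.
rewrite -(integral_refl t (g := fun y =>
  (rescale K eta (t - y) * rescale K h y)%:E)).
  by apply: eq_integral => y _; rewrite subKr mulrC.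
apply/measurable_EFinP; exact: measurable_conv_integrand2.
Qed.

Section positive_bandwidths.
Variables h eta : 'rV[R]_d.
Hypotheses (h0 : forall j, 0 < h ord0 j) (eta0 : forall j, 0 < eta ord0 j).

Let vh0 : 0 < vol h. Proof. exact: prodr_gt0. Qed.
Let ve0 : 0 < vol eta. Proof. exact: prodr_gt0. Qed.

Let side t (j : 'I_d) : set (measurableTypeR R) :=
  `[t ord0 j - 2^-1 * h ord0 j, t ord0 j + 2^-1 * h ord0 j]%classic
  `&` `[- (2^-1 * eta ord0 j), 2^-1 * eta ord0 j]%classic.

Let measurable_side t j : measurable (side t j).
Proof. by apply: measurableI; exact: measurable_itv. Qed.

Let overlap t : set 'rV[R]_d := [set y | forall j, side t j (y ord0 j)].

Let measurable_overlap t : measurable (overlap t).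
Proof. exact: (measurable_box (measurable_side t)). Qed.

Let itv_le (l r c : R) : 0 <= c -> r - l <= c ->
  (lebesgue_measure (`[l, r]%classic : set (measurableTypeR R)) <= c%:E)%E.
Proof.
move=> c0 lrc; rewrite lebesgue_measure_itv/= lte_fin.
by case: ifP => _; rewrite -?EFinB lee_fin.
Qed.

(** The two supports meet in a box with sides at most [min (h_j, eta_j)]. *)
Let overlap_le t : (leb (overlap t) <=
  (\prod_j Num.min (h ord0 j) (eta ord0 j))%:E)%E.
Proof.
rewrite [leLHS](lebesgue_rV_box (measurable_side t)).
rewrite -prodEFin; apply: lee_prod => j; rewrite measure_ge0/=.
have := h0 j; have := eta0 j => ej hj.
rewrite EFin_min le_min; apply/andP; split.
  apply: (@le_trans _ _ (lebesgue_measure (`[t ord0 j - 2^-1 * h ord0 j,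
      t ord0 j + 2^-1 * h ord0 j]%classic : set (measurableTypeR R)))).
    apply: le_measure; rewrite ?inE; [exact: measurable_side|exact: measurable_itv|].
    exact: subIsetl.
  by apply: itv_le; lra.
apply: (@le_trans _ _ (lebesgue_measure (`[- (2^-1 * eta ord0 j),
    2^-1 * eta ord0 j]%classic : set (measurableTypeR R)))).
  apply: le_measure; rewrite ?inE; [exact: measurable_side|exact: measurable_itv|].
  exact: subIsetr.
by apply: itv_le; lra.
Qed.

Let M := supnorm K ^+ 2 / (vol h * vol eta).

Let M0 : 0 <= M.
Proof. exact: divr_ge0 (sqr_ge0 _) (mulr_ge0 (ltW vh0) (ltW ve0)). Qed.

Lemma conv_integrand_le t y :
  `|rescale K h (t - y) * rescale K eta y| <= M * \1_(overlap t) y.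
Proof.
have [_ suppK _ _] := kerK.
rewrite indicE; have [_|] := boolP (y \in overlap t).
  have := ler_pM (normr_ge0 _) (normr_ge0 _)
    (rescale_bound (t - y) vh0 kernel_le) (rescale_bound y ve0 kernel_le).
  rewrite -normrM => /le_trans; apply; rewrite mulr1 /M le_eqVlt.
  by apply/orP; left; apply/eqP; field; rewrite ?gt_eqF.
rewrite notin_setE mulr0 => /existsNP[j].
have [ty|ty] := leP `|(t - y) ord0 j| (2^-1 * h ord0 j); last first.
  by rewrite (rescale_supp h0 suppK) ?mul0r ?normr0//; exists j.
have [yj|yj] := leP `|y ord0 j| (2^-1 * eta ord0 j); last first.
  by rewrite (rescale_supp eta0 suppK (t := y)) ?mulr0 ?normr0//; exists j.
case; split => /=; rewrite in_itv/=.
  by move: ty; rewrite !mxE ler_norml => /andP[? ?]; apply/andP; split; lra.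
by move: yj; rewrite ler_norml.
Qed.

Lemma conv_abs_integral_le t :
  (\int[leb]_y `|rescale K h (t - y) * rescale K eta y|%:E <=
   (supnorm K ^+ 2 / vol (max_rV h eta))%:E)%E.
Proof.
have mM0 : 0 <= \prod_j Num.min (h ord0 j) (eta ord0 j).
  by apply: prodr_ge0 => j _; rewrite le_min !ltW.
apply: (@le_trans _ _ (M * \prod_j Num.min (h ord0 j) (eta ord0 j))%:E).
  apply: (@le_trans _ _ (\int[leb]_y (M * \1_(overlap t) y)%:E)%E).
    by apply: le_nonneg_integral => y; rewrite ?lee_fin//= conv_integrand_le.
  under eq_integral do rewrite EFinM.
  rewrite ge0_integralZl_EFin//; last first.
    by apply/measurable_EFinP; exact: measurable_indic.
  rewrite integral_indic// setIT [leRHS]EFinM; apply: lee_wpmul2l => //.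
  exact: overlap_le.
rewrite lee_fin.
rewrite /M; move: (supnorm K ^+ 2) (sqr_ge0 (supnorm K)) => S S0.
rewrite -!mulrA; apply: ler_wpM2l => //.
rewrite ler_pdivrMl ?mulr_gt0// ler_pdivlMr; last first.
  by apply: prodr_gt0 => j _; rewrite mxE lt_max h0.
rewrite -!big_split/= le_eqVlt; apply/orP; left; apply/eqP.
apply: eq_bigr => j _; rewrite mxE.
by case: leP => _; rewrite 1?mulrC.
Qed.

Lemma integrable_conv_integrand t : leb.-integrable setT
  (EFin \o (fun y => rescale K h (t - y) * rescale K eta y)).
Proof.
apply/integrableP; split.
  apply/measurable_EFinP; exact: measurable_conv_integrand2.
by apply: le_lt_trans (conv_abs_integral_le t) _; rewrite ltry.
Qed.

Lemma conv2_le t :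
  `|conv2 K h eta t| <= supnorm K ^+ 2 / vol (max_rV h eta).
Proof.
apply: (le_trans (le_normr_Rintegral measurableT (integrable_conv_integrand t))).
rewrite -lee_fin -EFin_Rintegral; first exact: conv_abs_integral_le.
by have := integrable_norm (integrable_conv_integrand t); exact.
Qed.

Lemma conv2_supp t :
  (exists j, Num.max (h ord0 j) (eta ord0 j) < `|t ord0 j|) -> conv2 K h eta t = 0.
Proof.
move=> [j tj]; rewrite /conv2 /Rintegral integral0_eq// => y _; congr EFin.
apply/eqP; rewrite -normr_le0; apply: le_trans (conv_integrand_le t y) _.
rewrite indicE memNset ?mulr0//= => /(_ j)[]; rewrite /= !in_itv/=.
move=> /andP[y1 y2] /andP[y3 y4].
move: tj; rewrite gt_max => /andP[].
by rewrite !lter_normr => /orP[|] h1 /orP[|] h2; lra.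
Qed.

End positive_bandwidths.

Section Qsup_facts.
Variable n : nat.
Local Notation H := (@bandwidths R d n).
Local Notation Q := (Qsup n K).

Lemma QsupE t : Q t = sup [set `|Qpair K p.1 p.2 t| | p in H `*` H].
Proof. by rewrite /Qsup image2E; congr sup; apply: eq_imagel => -[]. Qed.

Let finHH : finite_set (H `*` H).
Proof. by apply: finite_setX; exact: bandwidths_finite. Qed.

Lemma Qsup_ge h eta t : H h -> H eta -> `|Qpair K h eta t| <= Q t.
Proof.
move=> Hh He; rewrite QsupE.
exact: (fin_sup_ge (fun p => `|Qpair K p.1 p.2 t|) finHH (x := (h, eta))).
Qed.

Lemma Qsup_in t : exists h, exists eta, [/\ H h, H eta & Q t = `|Qpair K h eta t|].
Proof.
rewrite QsupE.
have [[h eta] [/= Hh He] ->] := fin_sup_in (fun p => `|Qpair K p.1 p.2 t|) finHH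
  (x := (const_mx 1, const_mx 1)) (conj (@bandwidth_one R d n) (@bandwidth_one R d n)).
by exists h, eta.
Qed.

Lemma Qsup_ge0 t : 0 <= Q t.
Proof. by have [h [eta [_ _ ->]]] := Qsup_in t. Qed.

Lemma Qsup_le t : Q t <= supnorm K ^+ 2.
Proof.
have [h [eta [Hh He ->]]] := Qsup_in t.
have V0 := vol_gt0 (max_bandwidth Hh He).
rewrite normrM (gtr0_norm V0) mulrC -ler_pdivlMr//.
by apply: conv2_le => j; exact: bandwidth_gt0.
Qed.

Lemma Qsup_supp t : (exists j, 1 < `|t ord0 j|) -> Q t = 0.
Proof.
move=> [j tj]; have [h [eta [Hh He ->]]] := Qsup_in t.
rewrite /Qpair conv2_supp ?mulr0 ?normr0//.
- by move=> i; exact: bandwidth_gt0.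
- by move=> i; exact: bandwidth_gt0.
exists j; have m0 := bandwidth_gt0 j (max_bandwidth Hh He).
by rewrite !mxE in m0 *; rewrite normrM (gtr0_norm m0) ltr_pMr.
Qed.

(** This is what [Qsup] is for: after rescaling it dominates all the convolved
    kernels whose bandwidths have the given maximum. *)
Lemma conv2_le_Qsup h eta t : H h -> H eta ->
  `|conv2 K h eta t| <= `|rescale Q (max_rV h eta) t|.
Proof.
move=> Hh He; have Hm := max_bandwidth Hh He; have V0 := vol_gt0 Hm.
rewrite normrM normfV (gtr0_norm V0) ler_pdivlMl// (ger0_norm (Qsup_ge0 _)).
apply: le_trans (Qsup_ge (div_rV t (max_rV h eta)) Hh He).
rewrite /Qpair normrM (gtr0_norm V0) (_ : mul_rV _ _ = t)//.
apply/rowP => j; have := bandwidth_gt0 j Hm; rewrite !mxE => m0.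
by rewrite mulrC divfK// gt_eqF.
Qed.

Lemma measurable_Qsup : measurable_fun [set: 'rV[R]_d] Q.
Proof.
pose grid := {ffun 'I_d -> 'I_(trunc_log 2 n).+1}.
pose q (p : grid * grid) t := `|Qpair K (bandwidth_of R p.1) (bandwidth_of R p.2) t|.
rewrite (_ : Q = fun t => \big[Num.max/0]_p q p t); last first.
  apply/funext => t; apply/eqP; rewrite eq_le; apply/andP; split.
    have [h [eta []]] := Qsup_in t; rewrite bandwidthsE.
    by move=> [k _ <-] [l _ <-] ->; exact: (@le_bigmax _ _ _ _ (q^~ t) (k, l)).
  apply: bigmax_le => [|[k l] _]; first exact: Qsup_ge0.
  by apply: Qsup_ge; rewrite bandwidthsE; [exists k|exists l].
have mq p : measurable_fun [set: 'rV[R]_d] (q p).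
  apply: measurableT_comp => //; apply: measurable_funM => //.
  apply: measurableT_comp; first exact: measurable_conv2.
  rewrite (_ : mul_rV _ = fun t => \row_j (max_rV (bandwidth_of R p.1)
      (bandwidth_of R p.2) ord0 j * t ord0 j)); last first.
    by apply/funext => t; apply/rowP => j; rewrite !mxE.
  by apply: (measurable_map_rV (u := fun j a => max_rV (bandwidth_of R p.1)
    (bandwidth_of R p.2) ord0 j * a)) => j; exact: measurable_funM.
elim: (index_enum _) => [|p s IH].
  by under eq_fun do rewrite big_nil; exact: measurable_cst.
by under eq_fun do rewrite big_cons; exact: measurable_maxr.
Qed.

End Qsup_facts.
End kernel.

(** * The oracle inequality *)

Section empirical_majorant.
Variable R : realType.
Implicit Types a b lam chi : R.

(** Solving the quadratic inequality [`|b - a| <= sqrt (a * lam) + lam + chi] in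
    the square roots makes the true and the empirical majorants comparable. *)
Lemma majorant_compare a b lam chi :
  0 <= a -> 0 <= b -> 0 <= lam -> 0 <= chi ->
  `|b - a| <= Num.sqrt (a * lam) + lam + chi ->
  Num.sqrt (a * lam) + lam <= 4 * Num.sqrt (b * lam) + 4 * lam + chi / 2 /\
  4 * Num.sqrt (b * lam) + 4 * lam <=
    10 * (Num.sqrt (a * lam) + lam) + 2 * chi.
Proof.
move=> a0 b0 lam0 chi0; rewrite ler_norml => /andP[h1 h2].
set T := Num.sqrt (a * lam) in h1 h2 *; set p := Num.sqrt (b * lam).
have T0 : 0 <= T by exact: sqrtr_ge0.
have p0 : 0 <= p by exact: sqrtr_ge0.
have T2 : T ^+ 2 = a * lam by rewrite sqr_sqrtr// mulr_ge0.
have p2 : p ^+ 2 = b * lam by rewrite sqr_sqrtr// mulr_ge0.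
have hT : T ^+ 2 <= p ^+ 2 + T * lam + lam ^+ 2 + lam * chi by nra.
have hp : p ^+ 2 <= T ^+ 2 + T * lam + lam ^+ 2 + lam * chi by nra.
split.
  suff : T <= 4 * p + 3 * lam + chi / 2 by lra.
  rewrite leNgt; apply/negP => hlt.
  have : (4 * p + 3 * lam + chi / 2) * (4 * p + 2 * lam + chi / 2) < T * (T - lam).
    apply: ltr_pM; rewrite //; [by nra|by nra|lra].
  nra.
suff : p <= 5 / 2 * T + 3 / 2 * lam + chi / 2 by lra.
rewrite leNgt; apply/negP => hlt.
have : (5 / 2 * T + 3 / 2 * lam + chi / 2) ^+ 2 < p ^+ 2.
  by rewrite !expr2; apply: ltr_pM; rewrite //; lra.
nra.
Qed.

End empirical_majorant.

Section bias_convolution.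
Variables (R : realType) (d : nat) (K f : 'rV[R]_d -> R).
Hypotheses (kerK : is_kernel K) (denf : is_density f).
Local Notation leb := (@lebesgue_rV R d).
Implicit Types (h eta t x y : 'rV[R]_d).

Let mf : measurable_fun [set: 'rV[R]_d] f. Proof. by case: denf. Qed.
Let f0 t : 0 <= f t. Proof. by case: denf. Qed.

Variables h eta : 'rV[R]_d.
Hypotheses (h0 : forall j, 0 < h ord0 j) (eta0 : forall j, 0 < eta ord0 j).

Let ve0 : 0 < vol eta. Proof. exact: prodr_gt0. Qed.

Section at_point.
Variable x : 'rV[R]_d.

Let F (p : 'rV[R]_d * 'rV[R]_d) : R :=
  rescale K eta (p.1 - x) * (rescale K h (p.2 - p.1) * f p.2).

Let mK := measurable_kernel kerK.

Let mF : measurable_fun [set: 'rV[R]_d * 'rV[R]_d] F.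
Proof.
apply: measurable_funM.
  apply: (measurableT_comp (measurable_shift x (measurable_rescale eta mK))
    (g := fst)); exact: measurable_fst.
apply: measurable_funM.
  apply: (measurableT_comp (measurable_rescale h mK)
    (g := fun p : 'rV[R]_d * 'rV[R]_d => p.2 - p.1)).
  exact: measurable_rVB.
apply: (measurableT_comp mf (g := snd)); exact: measurable_snd.
Qed.

Let g y u := rescale K h (y - x - u) * rescale K eta u.

Let FE t y : F (t, y) = g y (t - x) * f y.
Proof.
rewrite /F /g/= (_ : y - x - (t - x) = y - t); first by ring.
by rewrite opprB addrA subrK.
Qed.

Let mg y : measurable_fun [set: 'rV[R]_d] (g y).
Proof. exact: (measurable_conv_integrand2 kerK). Qed.

Let integral_F_shift y :
  (\int[leb]_t (F (t, y))%:E = \int[leb]_u (g y u * f y)%:E)%E.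
Proof.
rewrite -(integral_shift x (g := fun u => (g y u * f y)%:E)).
  by apply: eq_integral => t _; rewrite FE.
by apply/measurable_EFinP; exact: measurable_funM.
Qed.

Let integral_F y :
  (\int[leb]_t (F (t, y))%:E = (conv2 K h eta (y - x) * f y)%:E)%E.
Proof.
have ig := integrable_conv_integrand kerK h0 eta0 (y - x).
rewrite integral_F_shift EFin_Rintegral; last first.
  have := integrableZl measurableT (f y) ig; apply: eq_integrable => // u _ /=.
  by rewrite -EFinM mulrC.
by rewrite RintegralZr.
Qed.

(* The absolute integral is bounded with [t] integrated first, uniformly in [y]. *)
Let iF : (leb \x leb)%E.-integrable setT (EFin \o F).
Proof.
have mEF : measurable_fun [set: 'rV[R]_d * 'rV[R]_d] (EFin \o F).
  exact/measurable_EFinP.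
apply/(integrable21ltyP _ _ mEF).
pose C := supnorm K ^+ 2 / vol (max_rV h eta).
apply: (@le_lt_trans _ _ (\int[leb]_y (C%:E * (f y)%:E))%E).
  apply: le_nonneg_integral => y; first exact: integral_ge0.
  rewrite [leLHS](_ : _ = \int[leb]_u ((f y)%:E * `|g y u|%:E))%E.
    rewrite ge0_integralZl_EFin//; last first.
      by apply/measurable_EFinP; apply: measurableT_comp => //; exact: mg.
    rewrite muleC; apply: lee_wpmul2r; first by rewrite lee_fin.
    exact: conv_abs_integral_le.
  rewrite -(integral_shift x (g := fun u => ((f y)%:E * `|g y u|%:E)%E)).
    apply: eq_integral => t _; rewrite /= FE normrM (ger0_norm (f0 y)).
    by rewrite mulrC EFinM.
  apply: emeasurable_funM => //.
  by apply/measurable_EFinP; apply: measurableT_comp => //; exact: mg.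
rewrite ge0_integralZl//; last 3 first.
- exact/measurable_EFinP.
- by move=> y _; rewrite lee_fin.
- rewrite lee_fin divr_ge0 ?sqr_ge0// ltW//; apply: prodr_gt0 => j _.
  by rewrite mxE lt_max h0.
by case: denf => _ _ ->; rewrite mule1 ltry.
Qed.

(** By Fubini's theorem, smoothing with [K_eta] a function already smoothed with
    [K_h] amounts to smoothing with [K_h * K_eta].  Consequently the two estimators
    compared by the selection rule differ in mean by the smoothed bias only. *)
Lemma smoothed_bias :
  \int[leb]_t (rescale K eta (t - x) * bias K h f t) =
  \int[leb]_t (conv2 K h eta (t - x) * f t) -
  \int[leb]_t (rescale K eta (t - x) * f t).
Proof.
pose J t := \int[leb]_y (rescale K h (y - t) * f y).
have iJ t : leb.-integrable setT (EFin \o (fun y => rescale K h (y - t) * f y)).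
  apply: integrable_mul_density => //.
    exact: measurable_shift (measurable_rescale h mK).
  by move=> u; exact: rescale_bound (prodr_gt0 _ _) (kernel_le kerK).
have GE t : (fubini_F leb (EFin \o F) t = (rescale K eta (t - x) * J t)%:E)%E.
  rewrite /fubini_F /J -RintegralZl// -EFin_Rintegral//.
  exact: integrableZl (iJ t).
have iG : leb.-integrable setT (EFin \o (fun t => rescale K eta (t - x) * J t)).
  by apply: eq_integrable (integrable_fubini_F iF) => // t _; rewrite GE.
have iK : leb.-integrable setT (EFin \o (fun t => rescale K eta (t - x) * f t)).
  apply: integrable_mul_density => //.
    exact: measurable_shift (measurable_rescale eta mK).
  by move=> u; exact: rescale_bound ve0 (kernel_le kerK).
transitivity (\int[leb]_t (rescale K eta (t - x) * J t -
                           rescale K eta (t - x) * f t)).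
  by apply: eq_Rintegral => t _; rewrite /bias -mulrBr.
rewrite RintegralB//; congr (_ - _); rewrite /Rintegral; congr fine.
rewrite -[LHS](eq_integral _ _ (fun t _ => GE t)).
rewrite (Fubini iF); apply: eq_integral => y _; exact: integral_F.
Qed.

End at_point.
End bias_convolution.

Section oracle.
Variables (R : realType) (d n : nat) (xs : 'I_n -> 'rV[R]_d) (kappa : R)
  (K f : 'rV[R]_d -> R).
Hypotheses (n_gt0 : (0 < n)%N) (kappa_gt0 : 0 < kappa).
Hypotheses (kerK : is_kernel K) (denf : is_density f).
Variable x : 'rV[R]_d.
Local Notation leb := (@lebesgue_rV R d).
Local Notation H := (@bandwidths R d n).
Local Notation Q := (Qsup n K).
Local Notation Z := (zeta xs kappa K f x).
Local Notation Chi := (chi xs kappa K f x).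
Local Notation M g h := (majorant n kappa f g h x).
Local Notation Mhat g h := (majorant_hat xs kappa g h x).
Implicit Types h eta : 'rV[R]_d.

Let finH : finite_set H. Proof. exact: bandwidths_finite. Qed.
Let f0 t : 0 <= f t. Proof. by case: denf. Qed.
Let n0 : 0 < n%:R :> R. Proof. by rewrite ltr0n. Qed.

Lemma pos_part_ge0 (u : R) : 0 <= pos_part u.
Proof. by rewrite /pos_part le_max lexx orbT. Qed.

Lemma le_pos_part (u : R) : u <= pos_part u.
Proof. by rewrite /pos_part le_max lexx. Qed.

Lemma xi_le h : H h -> `|xi xs K f h x| <= M K h + Z.
Proof.
move=> Hh; rewrite -lerBlDl; apply: le_trans (le_pos_part _) _.
rewrite /zeta le_max; apply/orP; left.
exact: (fin_sup_ge (fun h => pos_part (`|xi xs K f h x| - M K h)) finH).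
Qed.

Lemma xi2_le h eta : H h -> H eta ->
  `|xi2 xs K f h eta x| <= M Q (max_rV h eta) + Z.
Proof.
move=> Hh He; rewrite -lerBlDl; apply: le_trans (le_pos_part _) _.
rewrite /zeta le_max; apply/orP; right; rewrite image2E.
apply: (fin_sup_ge (uncurry (fun h eta =>
  pos_part (`|xi2 xs K f h eta x| - M Q (max_rV h eta)))) _ (x := (h, eta))) => //.
exact: finite_setX.
Qed.

Lemma zeta_ge0 : 0 <= Z.
Proof.
rewrite /zeta le_max; apply/orP; left.
apply: le_trans (fin_sup_ge (fun h => pos_part (`|xi xs K f h x| - M K h)) finH
  (@bandwidth_one R d n)).
exact: pos_part_ge0.
Qed.

Lemma Ahat_dev_le g h : H h -> g = K \/ g = Q ->
  `|Ahat xs g h x - Aex f g h x| <= M g h + Chi.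
Proof.
move=> Hh gKQ; rewrite -lerBlDl; apply: le_trans (le_pos_part _) _.
have : pos_part (`|Ahat xs g h x - Aex f g h x| - M g h) <= chi_of xs kappa f g x.
  exact: (fin_sup_ge
    (fun h => pos_part (`|Ahat xs g h x - Aex f g h x| - M g h)) finH).
by move=> /le_trans; apply; rewrite /chi le_max; case: gKQ => ->;
  rewrite lexx ?orbT.
Qed.

Lemma chi_ge0 : 0 <= Chi.
Proof.
rewrite /chi le_max; apply/orP; left.
apply: le_trans (fin_sup_ge (fun h =>
  pos_part (`|Ahat xs K h x - Aex f K h x| - M K h)) finH (@bandwidth_one R d n)).
exact: pos_part_ge0.
Qed.

Lemma majorant_hatP g h : H h -> g = K \/ g = Q ->
  M g h <= Mhat g h + Chi / 2 /\ Mhat g h <= 10 * M g h + 2 * Chi.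
Proof.
move=> Hh gKQ; have V0 := vol_gt0 Hh.
pose lam := kappa * ln n%:R / (n%:R * vol h).
have lam0 : 0 <= lam.
  by rewrite divr_ge0 ?mulr_ge0 ?ln_ge0 ?ler1n ?ltW.
have A0 : 0 <= Aex f g h x.
  by apply: Rintegral_ge0 => t _; rewrite mulr_ge0.
have Ah0 : 0 <= Ahat xs g h x.
  by apply: mulr_ge0; [rewrite invr_ge0 ltW|apply: sumr_ge0].
have ME : M g h = Num.sqrt (Aex f g h x * lam) + lam.
  by rewrite /majorant /lam; congr (Num.sqrt _ + _); ring.
have MhE : Mhat g h = 4 * Num.sqrt (Ahat xs g h x * lam) + 4 * lam.
  by rewrite /majorant_hat /lam; congr (4 * Num.sqrt _ + _); ring.
have := Ahat_dev_le Hh gKQ; rewrite MhE ME.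
exact: majorant_compare A0 Ah0 lam0 chi_ge0.
Qed.

Let above h := [set eta | H eta /\ le_rV h eta].
Let Ssup h := sup [set M Q eta | eta in above h].
Let Shat h := sup [set Mhat Q eta | eta in above h].
Let gap h eta := `|fhat2 xs K h eta x - fhat xs K eta x|
  - Mhat Q (max_rV h eta) - Mhat K eta.
Let Gap h := sup [set pos_part (gap h eta) | eta in H].

Let finabove h : finite_set (above h).
Proof. by apply: sub_finite_set finH => eta []. Qed.

Let above_max h eta : H h -> H eta -> above h (max_rV h eta).
Proof. by move=> Hh He; split; [exact: max_bandwidth|exact: le_max_rVl]. Qed.

Let Shat_le h : H h -> Shat h <= 10 * Ssup h + 2 * Chi.
Proof.
move=> Hh; rewrite /Shat; have [eta [He le_he] ->] := fin_sup_in (fun eta => Mhat Q eta)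
  (finabove h) (above_max Hh Hh).
have [_] := majorant_hatP He (or_intror erefl).
have : M Q eta <= Ssup h by exact: (fin_sup_ge (fun eta => M Q eta) (finabove h)).
lra.
Qed.

Let Mhat_max_le h eta : H h -> H eta -> Mhat Q (max_rV h eta) <= Shat h.
Proof.
move=> Hh He; exact: (fin_sup_ge (fun eta => Mhat Q eta) (finabove h)
  (above_max Hh He)).
Qed.

Let gap_le h eta : H h -> H eta ->
  `|fhat2 xs K h eta x - fhat xs K eta x| <=
  Gap h + Mhat Q (max_rV h eta) + Mhat K eta.
Proof.
move=> Hh He.
have := le_trans (le_pos_part (gap h eta))
  (fin_sup_ge (fun eta => pos_part (gap h eta)) finH He).
rewrite -/(Gap h) /gap; lra.
Qed.

Let Gap_le h : H h -> Gap h <= max_bias n K h f x + 2 * Z + Chi.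
Proof.
move=> Hh; rewrite /Gap; have [eta He ->] := fin_sup_in (fun eta => pos_part (gap h eta)) finH
  (@bandwidth_one R d n).
have h0 j : 0 < h ord0 j by exact: bandwidth_gt0.
have eta0 j : 0 < eta ord0 j by exact: bandwidth_gt0.
have B0 : 0 <= max_bias n K h f x by rewrite /max_bias le_max normr_ge0.
rewrite /pos_part ge_max; apply/andP; split; last first.
  by have := zeta_ge0; have := chi_ge0; lra.
have B1 : `|\int[leb]_t (rescale K eta (t - x) * bias K h f t)| <=
    max_bias n K h f x.
  rewrite /max_bias le_max; apply/orP; right.
  exact: (fin_sup_ge (fun eta =>
    `|\int[leb]_t (rescale K eta (t - x) * bias K h f t)|) finH).
have E : fhat2 xs K h eta x - fhat xs K eta x =
    \int[leb]_t (rescale K eta (t - x) * bias K h f t) +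
    (xi2 xs K f h eta x - xi xs K f eta x).
  by rewrite (smoothed_bias kerK denf h0 eta0) /xi2 /xi; ring.
have [MQ _] := majorant_hatP (max_bandwidth Hh He) (or_intror erefl).
have [MK _] := majorant_hatP He (or_introl erefl).
have X1 := xi_le He; have X2 := xi2_le Hh He.
rewrite /gap E.
have := ler_normD (\int[leb]_t (rescale K eta (t - x) * bias K h f t))
  (xi2 xs K f h eta x - xi xs K f eta x).
have := ler_normB (xi2 xs K f h eta x) (xi xs K f eta x).
lra.
Qed.

(** The deterministic heart of the selection rule.  Both [f_h] and the selected
    estimator are compared with the symmetric auxiliary estimator [f_{h, hh}],
    at a total cost of [Rhat h + Rhat hh <= 2 * Rhat h]; and [Rhat h] is, up to
    the stochastic errors, a bias term plus the majorants. *)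
Lemma oracle_inequality hh : is_argmin_Rhat xs kappa K x hh ->
  `|fhat xs K hh x - f x| <=
  oracle_bound n kappa K f x + 7 * Z + 18 * Chi.
Proof.
move=> [Hhh argmin]; rewrite /oracle_bound.
have [h Hh ->] := fin_inf_in (fun h => 4 * max_bias n K h f x
  + 60 * Ssup h + 61 * M K h) finH (@bandwidth_one R d n).
have RE eta : Rhat xs kappa K eta x = Gap eta + Shat eta + Mhat K eta by [].
have := argmin h Hh; rewrite !RE => Rle.
have g1 := gap_le Hh Hhh.
have g2 := gap_le Hhh Hh.
have sym : fhat2 xs K hh h x = fhat2 xs K h hh x.
  by rewrite /fhat2; congr (_ * _); apply: eq_bigr => i _; exact: conv2C.
rewrite sym in g2.
have m1 := Mhat_max_le Hh Hhh.
have m2 := Mhat_max_le Hhh Hh.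
have [_ MK] := majorant_hatP Hh (or_introl erefl).
have X1 := xi_le Hh.
have GL := Gap_le Hh.
have SL := Shat_le Hh.
have Bh : `|bias K h f x| <= max_bias n K h f x by rewrite /max_bias le_max lexx.
have fE : fhat xs K h x - f x = xi xs K f h x + bias K h f x.
  by rewrite /xi /bias; ring.
have Z0 := zeta_ge0; have C0 := chi_ge0.
have M0 : 0 <= M K h.
  rewrite addr_ge0 ?sqrtr_ge0// divr_ge0 ?mulr_ge0 ?ln_ge0 ?ler1n ?ltW//.
  exact: vol_gt0 Hh.
have S0 : 0 <= Ssup h.
  apply: le_trans (fin_sup_ge (fun eta => M Q eta) (finabove h)
    (above_max Hh Hh)).
  rewrite addr_ge0 ?sqrtr_ge0// divr_ge0 ?mulr_ge0 ?ln_ge0 ?ler1n ?ltW//.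
  exact: vol_gt0 (max_bandwidth Hh Hh).
have B0 : 0 <= max_bias n K h f x by exact: le_trans (normr_ge0 _) Bh.
have t1 := ler_distD (fhat2 xs K h hh x) (fhat xs K hh x) (fhat xs K h x).
have t2 := ler_distD (fhat xs K h x) (fhat xs K hh x) (f x).
have t3 := ler_normD (xi xs K f h x) (bias K h f x).
rewrite -fE in t3.
rewrite (distrC (fhat xs K hh x) (fhat2 _ _ _ _ _)) in t1.
rewrite (max_rVC hh h) in g2 m2.
lra.
Qed.

End oracle.

(** * The moments of the stochastic errors *)

Section unit_cube.
Variables (R : realType) (d : nat) (f : 'rV[R]_d -> R).
Hypothesis denf : is_density f.
Local Notation leb := (@lebesgue_rV R d).

Let mf : measurable_fun [set: 'rV[R]_d] f. Proof. by case: denf. Qed.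
Let f0 t : 0 <= f t. Proof. by case: denf. Qed.

Definition near_diagonal : set ('rV[R]_d * 'rV[R]_d) :=
  [set p : 'rV[R]_d * 'rV[R]_d | forall j, `|p.1 ord0 j - p.2 ord0 j| <= 1].

(** The probability that an observation falls in the sup-norm unit ball around [x].
    It majorizes all the first moments [Aex] at [x], up to factors, and it is
    integrable in [x]. *)
Definition cube_mass x := \int[leb]_t (\1_near_diagonal (t, x) * f t).

Lemma measurable_near_diagonal : measurable near_diagonal.
Proof.
have -> : near_diagonal = (fun p : 'rV[R]_d * 'rV[R]_d => p.1 - p.2) @^-1`
    [set v | forall j, `[-1, 1]%classic (v ord0 j)].
  by apply/seteqP; split => p /= h j; have := h j; rewrite !mxE in_itv/= ler_norml.
have mB : measurable_fun [set: 'rV[R]_d * 'rV[R]_d] (fun p => p.1 - p.2).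
  exact: measurable_rVB.
rewrite -[X in measurable X]setTI; apply: mB => //.
by apply: (measurable_box (A := fun=> `[-1, 1]%classic)) => j; exact: measurable_itv.
Qed.

Lemma measurable_near_slice x :
  measurable_fun [set: 'rV[R]_d] (fun t => \1_near_diagonal (t, x) : R).
Proof.
apply: (measurableT_comp (measurable_indic measurable_near_diagonal)
  (g := fun t : 'rV[R]_d => (t, x))); exact: measurable_fun_pair.
Qed.

Lemma near_slice_le x t : `|\1_near_diagonal (t, x)| <= 1 :> R.
Proof. by rewrite indicE; case: (_ \in _); rewrite ?normr1 ?normr0. Qed.

Lemma cube_massE x :
  ((cube_mass x)%:E = \int[leb]_t (\1_near_diagonal (t, x) * f t)%:E)%E.
Proof.
rewrite EFin_Rintegral//.
exact: integrable_mul_density (measurable_near_slice x) (near_slice_le x).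
Qed.

Lemma cube_mass_ge0 x : 0 <= cube_mass x.
Proof. by apply: Rintegral_ge0 => t _; rewrite mulr_ge0. Qed.

Lemma measurable_near_density : measurable_fun [set: 'rV[R]_d * 'rV[R]_d]
  (fun p => (\1_near_diagonal p * f p.1)%:E).
Proof.
apply/measurable_EFinP/measurable_funM.
  exact: measurable_indic measurable_near_diagonal.
apply: (measurableT_comp mf (g := fst)); exact: measurable_fst.
Qed.

Lemma measurable_cube_mass :
  measurable_fun [set: 'rV[R]_d] (fun x => (cube_mass x)%:E).
Proof.
under eq_fun do rewrite cube_massE.
apply: (measurable_fun_fubini_tonelli_G (fun p => (\1_near_diagonal p * f p.1)%:E)).
  exact: measurable_near_density.
by move=> p; rewrite lee_fin mulr_ge0.
Qed.

(** By Tonelli this is the volume [2 ^ d] of a unit ball of the sup norm, since [f] has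
    mass one. *)
Lemma integral_cube_mass : (\int[leb]_x (cube_mass x)%:E = (2 ^+ d)%:E)%E.
Proof.
under eq_integral do rewrite cube_massE.
have mp := measurable_near_density.
rewrite -(fubini_tonelli (fun p => (\1_near_diagonal p * f p.1)%:E))//; last first.
  by move=> p; rewrite lee_fin mulr_ge0.
have -> : ((2 ^+ d)%:E = \int[leb]_t ((2 ^+ d)%:E * (f t)%:E))%E.
  rewrite ge0_integralZl_EFin//.
  - by case: denf => _ _ ->; rewrite mule1.
  - by move=> t _; rewrite lee_fin.
  - exact/measurable_EFinP.
apply: eq_integral => t _.
under eq_integral do rewrite mulrC EFinM.
pose side (j : 'I_d) : set (measurableTypeR R) :=
  `[t ord0 j - 1, t ord0 j + 1]%classic.
have mside j : measurable (side j) by exact: measurable_itv.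
have mB := measurable_box mside.
rewrite (_ : (\int[leb]_x _)%E = \int[leb]_x ((f t)%:E *
    (\1_[set x : 'rV[R]_d | forall j, side j (x ord0 j)] x)%:E))%E; last first.
  apply: eq_integral => x _; congr (_ * (_)%:E)%E; rewrite !indicE; congr (_%:R).
  congr nat_of_bool; apply/idP/idP; rewrite !inE/= => h j; have := h j;
    rewrite /side /= !in_itv/= ler_norml => /andP[? ?]; apply/andP; split; lra.
rewrite ge0_integralZl_EFin//; last first.
  by apply/measurable_EFinP; exact: measurable_indic.
rewrite integral_indic// setIT [X in (_ * X)%E](lebesgue_rV_box mside).
rewrite muleC; congr (_ * _)%E; rewrite -[d in RHS]card_ord -prodr_const -prodEFin.
apply: eq_bigr => j _; rewrite /side lebesgue_measure_itv/= lte_fin ifT; last by lra.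
by rewrite -EFinB; congr EFin; lra.
Qed.

End unit_cube.

Section stochastic_errors.
Context {R : realType} {d n : nat} {dO : measure_display}
  {Omega : measurableType dO} (P : probability Omega R).
Variables (X : 'I_n -> {RV P >-> 'rV[R]_d}) (K f : 'rV[R]_d -> R).
Variables (kappa q : R).
Hypotheses (kerK : is_kernel K) (denf : is_density f).
Hypothesis iidX : iid_with_density X f.
Hypotheses (q_ge1 : 1 <= q) (n_ge3 : (3 <= n)%N).
Local Notation leb := (@lebesgue_rV R d).
Local Notation H := (@bandwidths R d n).
Local Notation Q := (Qsup n K).
Let B : R := Num.max (supnorm K) 1 ^+ 2.
Let D : R := (4 * d%:R + 2) * q + 4 * (d%:R + 1).
Hypothesis kappa_ge : B * D <= kappa.
Implicit Types (h eta t x : 'rV[R]_d).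

Let mf : measurable_fun [set: 'rV[R]_d] f. Proof. by case: denf. Qed.
Let f0 t : 0 <= f t. Proof. by case: denf. Qed.
Let n_gt0 : (0 < n)%N. Proof. exact: leq_trans n_ge3. Qed.
Let n0 : 0 < n%:R :> R. Proof. by rewrite ltr0n. Qed.
Let n1 : 1 <= n%:R :> R. Proof. by rewrite ler1n. Qed.

Let B_ge1 : 1 <= B.
Proof. by rewrite /B exprn_ege1// le_max lexx orbT. Qed.

Let D_ge1 : 1 <= D.
Proof.
have d0 : 0 <= d%:R :> R by exact: ler0n.
have dq : 0 <= d%:R * (q - 1) by rewrite mulr_ge0// subr_ge0.
move: q_ge1 dq d0; rewrite /D; move: (d%:R : R) => u q1 dq u0; lra.
Qed.

Let ln_n_ge1 : 1 <= ln n%:R :> R.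
Proof.
rewrite -[leLHS](expRK 1) ler_ln ?posrE ?expR_gt0//.
by apply: le_trans (expR1_le3 R) _; rewrite ler_nat.
Qed.

Let kappa0 : 0 < kappa.
Proof.
by apply: lt_le_trans kappa_ge; rewrite mulr_gt0 ?(lt_le_trans ltr01).
Qed.

Let supnorm2_le : supnorm K ^+ 2 <= B.
Proof.
by rewrite lerXn2r ?nnegrE ?supnorm_ge0 ?le_max ?ler01 ?lexx ?orbT.
Qed.

Let supnorm_le : supnorm K <= B.
Proof.
apply: (@le_trans _ _ (Num.max (supnorm K) 1)); first by rewrite le_max lexx.
by rewrite /B expr2 ler_peMr// le_max ?ler01 ?lexx orbT.
Qed.

Let base (b : bool) := if b then K else Q.

Let measurable_base b : measurable_fun [set: 'rV[R]_d] (base b).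
Proof. by case: b; [exact: measurable_kernel|exact: measurable_Qsup]. Qed.

Let base_le b t : `|base b t| <= B.
Proof.
case: b => /=; first exact: le_trans (kernel_le kerK t) supnorm_le.
by rewrite ger0_norm ?Qsup_ge0//; exact: le_trans (Qsup_le kerK n t) supnorm2_le.
Qed.

Let base_supp b t : (exists j, 1 < `|t ord0 j|) -> base b t = 0.
Proof.
case: b => /= -[j jt]; last by apply: Qsup_supp => //; exists j.
case: kerK => _ + _ _; apply; exists j; apply: le_lt_trans jt.
by rewrite invf_le1// ler1n.
Qed.

Let measurable_rescale_shift b h x :
  measurable_fun [set: 'rV[R]_d] (fun t => rescale (base b) h (t - x)).
Proof. by apply: measurable_shift; apply: measurable_rescale. Qed.

Lemma Aex_le b h x : H h -> Aex f (base b) h x <= B / vol h * cube_mass f x.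
Proof.
move=> Hh; have V0 := vol_gt0 Hh.
have BV0 : 0 <= B / vol h.
  by rewrite divr_ge0 ?(le_trans ler01 B_ge1)// ltW.
have ind_int := integrable_mul_density denf
  (@measurable_near_slice R d x) (near_slice_le x).
rewrite /cube_mass -RintegralZl// /Aex; apply: le_Rintegral => //.
- apply: (@integrable_mul_density _ _ _ denf _ (B / vol h)).
    exact: measurableT_comp.
  by move=> t; rewrite normr_id; exact: rescale_bound V0 (base_le b).
- by have := integrableZl measurableT (B / vol h) ind_int; apply: eq_integrable.
move=> t _; rewrite mulrA ler_wpM2r// indicE.
have [_|] := boolP ((t, x) \in _).
  by rewrite mulr1; exact: rescale_bound V0 (base_le b).
rewrite notin_setE => /existsNP[j /negP]; rewrite -ltNge /= => tx.
rewrite (@rescale_supp _ _ _ _ 1)// ?normr0 ?mulr0//.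
- by move=> i; exact: bandwidth_gt0.
- exact: base_supp.
exists j; rewrite mul1r !mxE; apply: le_lt_trans tx.
exact: bandwidth_le1.
Qed.

Let W : R := 2 * (B * n%:R ^+ d).

Section one_statistic.
Variables (b : bool) (h x : 'rV[R]_d) (phi : 'rV[R]_d -> R).
Hypotheses (Hh : H h) (mphi : measurable_fun [set: 'rV[R]_d] phi)
  (phi_le : forall t, `|phi t| <= `|rescale (base b) h (t - x)|).

Let V0 : 0 < vol h. Proof. exact: vol_gt0. Qed.

Let phib t : `|phi t| <= B / vol h.
Proof. exact: le_trans (phi_le t) (rescale_bound _ V0 (base_le b)). Qed.

Let phi_int : leb.-integrable setT (EFin \o (fun t => phi t * f t)).
Proof. exact: integrable_mul_density phib. Qed.

Let phi_abs : \int[leb]_t (`|phi t| * f t) <= Aex f (base b) h x.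
Proof.
apply: le_Rintegral => //.
- apply: (@integrable_mul_density _ _ _ denf _ (B / vol h)).
    exact: measurableT_comp.
  by move=> t; rewrite normr_id.
- apply: (@integrable_mul_density _ _ _ denf _ (B / vol h)).
    exact: measurableT_comp.
  by move=> t; rewrite normr_id; exact: rescale_bound V0 (base_le b).
- by move=> t _; rewrite ler_wpM2r.
Qed.

Definition empirical_dev (psi : 'rV[R]_d -> R) w :=
  n%:R^-1 * (\sum_i psi (X i w)) - \int[leb]_t (psi t * f t).

(** The deviation bound at the noise level [kappa * ln n / (n * vol h)]: the bound
    [B / vol h] on [phi] cancels the volume, and [kappa >= B * D] turns the
    exponential into the power [- D / 2] of [n]. *)
Lemma exceedance_prob :
  fine (P [set w | majorant n kappa f (base b) h x < `|empirical_dev phi w|]) <=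
  36 * (n%:R * cube_mass f x) * n%:R `^ (- (D / 2)).
Proof.
have B0 : 0 < B by exact: lt_le_trans B_ge1.
have b0 : 0 < B / vol h by rewrite divr_gt0.
pose lam := kappa * ln n%:R / (n%:R * vol h).
have nlam : n%:R * lam / (B / vol h) = kappa / B * ln n%:R.
  by rewrite /lam; field; rewrite ?gt_eqF.
have kB : D <= kappa / B by rewrite ler_pdivlMr// mulrC.
have nlamD : D * ln n%:R <= n%:R * lam / (B / vol h).
  by rewrite nlam ler_wpM2r// (le_trans ler01).
have blam : B / vol h <= n%:R * lam.
  rewrite -[leLHS]mul1r -ler_pdivlMr//; apply: le_trans nlamD.
  have := ler_pM ler01 ler01 D_ge1 ln_n_ge1; rewrite mulr1; exact.
have := deviation_prob denf iidX n_gt0 mphi b0 phib phi_abs blam.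
rewrite (_ : majorant _ _ _ _ _ _ =
    Num.sqrt (Aex f (base b) h x * lam) + lam); last first.
  by rewrite /majorant /lam; congr (Num.sqrt _ + _); ring.
move=> /le_trans; apply; apply: ler_pM.
- rewrite !mulr_ge0 ?invr_ge0 ?(ltW b0) ?(ltW n0)//.
  by apply: Rintegral_ge0 => t _; rewrite mulr_ge0.
- exact: expR_ge0.
- rewrite ler_pM2l// -mulrA ler_pM2l// ler_pdivrMr// mulrC; exact: Aex_le.
- rewrite /powR gt_eqF// ler_expR mulNr lerN2.
  rewrite (_ : n%:R * lam / (2 * (B / vol h)) =
    n%:R * lam / (B / vol h) / 2); first lra.
  by field; rewrite ?gt_eqF.
Qed.

(** [W] bounds every deviation, because the volumes are at least [n ^ - d]. *)
Lemma exceedance_le w : pos_part (`|empirical_dev phi w| -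
    majorant n kappa f (base b) h x) <=
  W * \1_[set w | majorant n kappa f (base b) h x < `|empirical_dev phi w|] w.
Proof.
rewrite indicE; set S := [set w | _].
have [|] := boolP (w \in S); last first.
  rewrite notin_setE /S/= mulr0 => /negP; rewrite -leNgt => h1.
  by rewrite /pos_part ge_max lexx andbT subr_le0.
rewrite inE /S/= mulr1 => dM.
have M0 : 0 <= majorant n kappa f (base b) h x.
  by rewrite addr_ge0 ?sqrtr_ge0// divr_ge0 ?mulr_ge0 ?ln_ge0 ?ler1n ?ltW.
have b0 : 0 <= B / vol h by exact: le_trans (normr_ge0 _) (phib 0).
have BW : B / vol h <= B * n%:R ^+ d.
  by rewrite ler_wpM2l ?(le_trans ler01)//; exact: invr_vol_le.
have W0 : 0 <= W by rewrite /W mulr_ge0// (le_trans b0).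
rewrite /pos_part ge_max W0 andbT lerBlDr.
apply: (@le_trans _ _ W); last by rewrite lerDl.
apply: (le_trans (ler_normB _ _)); rewrite /W mulr_natl mulr2n.
apply: lerD; apply: le_trans BW.
  rewrite normrM normfV (gtr0_norm n0) ler_pdivrMl//.
  apply: (le_trans (ler_norm_sum _ _ _)).
  apply: (@le_trans _ _ (\sum_(i < n) B / vol h)); first exact: ler_sum.
  by rewrite sumr_const card_ord mulr_natl.
apply: (le_trans (le_normr_Rintegral measurableT phi_int)).
apply: (@le_trans _ _ (\int[leb]_t (B / vol h * f t))).
  apply: le_Rintegral => //.
  - exact: integrable_norm phi_int.
  - have := integrableZl measurableT (B / vol h) (integrable_density denf).
    by apply: eq_integrable.
  - by move=> t _; rewrite normrM (ger0_norm (f0 t)) ler_wpM2r.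
rewrite RintegralZl//; last exact: integrable_density.
by rewrite Rintegral_density// mulr1.
Qed.

End one_statistic.

Let grid := {ffun 'I_d -> 'I_(trunc_log 2 n).+1}.
Let index := ((grid * grid) * (bool * bool))%type.
Let bw (k : grid) : 'rV[R]_d := bandwidth_of R k.

Let bwH k : H (bw k). Proof. by rewrite bandwidthsE; exists k. Qed.

Let bwP h : H h -> exists k, h = bw k.
Proof. by rewrite bandwidthsE => -[k _ <-]; exists k. Qed.

(* The first boolean selects absolute values (the errors in [chi]); the second
   selects [K] against [Q]. *)
Let stat x (i : index) : 'rV[R]_d -> R :=
  let: (k, l, (isabs, isK)) := i in
  if isabs then fun t => `|rescale (base isK) (bw k) (t - x)|
  else if isK then fun t => rescale K (bw k) (t - x)
  else fun t => conv2 K (bw k) (bw l) (t - x).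

Let stat_bw (i : index) : 'rV[R]_d :=
  let: (k, l, (isabs, isK)) := i in
  if isabs || isK then bw k else max_rV (bw k) (bw l).

Let event x (i : index) := [set w |
  majorant n kappa f (base i.2.2) (stat_bw i) x < `|empirical_dev (stat x i) w|].

Let stat_bwH i : H (stat_bw i).
Proof.
by case: i => [[k l] [[] []]] //=; apply: max_bandwidth.
Qed.

Let measurable_stat x i : measurable_fun [set: 'rV[R]_d] (stat x i).
Proof.
case: i => [[k l] [[] isK]] /=; first exact: measurableT_comp.
case: isK => /=; first exact: (measurable_rescale_shift true).
exact: measurable_shift (measurable_conv2 kerK _ _).
Qed.

Let stat_le x i t :
  `|stat x i t| <= `|rescale (base i.2.2) (stat_bw i) (t - x)|.
Proof.
case: i => [[k l] [[] isK]] /=; first by rewrite normr_id.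
by case: isK => //=; exact: conv2_le_Qsup.
Qed.

Let measurable_event x i : measurable (event x i).
Proof. exact: measurable_deviation. Qed.

Let event_prob x i : fine (P (event x i)) <=
  36 * (n%:R * cube_mass f x) * n%:R `^ (- (D / 2)).
Proof. exact: exceedance_prob (stat_bwH i) (measurable_stat x i) (stat_le x i). Qed.

Let event_le x i w : pos_part (`|empirical_dev (stat x i) w| -
    majorant n kappa f (base i.2.2) (stat_bw i) x) <= W * \1_(event x i) w.
Proof. exact: exceedance_le (stat_bwH i) (measurable_stat x i) (stat_le x i) w. Qed.

Let hits x w (c : bool * bool) : R := \sum_(p : grid * grid) \1_(event x (p, c)) w.

Let W0 : 0 <= W.
Proof.
exact: mulr_ge0 (ler0n R 2) (mulr_ge0 (le_trans ler01 B_ge1) (exprn_ge0 _ (ltW n0))).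
Qed.

Let powR_le_hits x w p c (u : R) : u = pos_part
    (`|empirical_dev (stat x (p, c)) w| -
     majorant n kappa f (base c.2) (stat_bw (p, c)) x) ->
  u `^ q <= W `^ q * hits x w c.
Proof.
move=> ->; have q0 : q != 0 by rewrite gt_eqF// (lt_le_trans ltr01).
apply: (@le_trans _ _ ((W * \1_(event x (p, c)) w) `^ q)).
  apply: (ge0_ler_powR (le_trans ler01 q_ge1)); rewrite ?nnegrE.
  - exact: pos_part_ge0.
  - exact: mulr_ge0 W0 _.
  - exact: event_le x (p, c) w.
apply: (@le_trans _ _ (W `^ q * \1_(event x (p, c)) w)).
  rewrite indicE; case: (w \in _); first by rewrite !mulr1.
  by rewrite !mulr0 powR0.
rewrite ler_wpM2l ?powR_ge0// /hits (bigD1 p)//= lerDl.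
by apply: sumr_ge0.
Qed.

(** A supremum of finitely many excesses is attained, so that its power is paid for
    by one of the exceedance events. *)
Let zeta_chi_le x w :
  zeta (X^~ w) kappa K f x `^ q + chi (X^~ w) kappa K f x `^ q <=
  W `^ q * \sum_i \1_(event x i) w.
Proof.
have maxq (u v : R) : Num.max u v `^ q <= u `^ q + v `^ q.
  by rewrite /Num.max; case: ifP => _; [rewrite lerDr powR_ge0|rewrite lerDl powR_ge0].
have E : \sum_i \1_(event x i) w = hits x w (false, true) +
    hits x w (false, false) + (hits x w (true, true) + hits x w (true, false)).
  transitivity (\sum_(c : bool * bool) hits x w c).
    rewrite /hits exchange_big pair_bigA/=; apply: eq_bigr => -[p c] _ //.
  rewrite (eq_bigr (fun c => hits x w (c.1, c.2))); last by move=> -[].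
  rewrite -(pair_bigA _ (fun a b => hits x w (a, b)))/= !big_bool/=.
  exact: addrC.
rewrite E !mulrDr; apply: lerD.
  apply: (le_trans (maxq _ _)); apply: lerD.
    have [h /bwP[k kh] hE] := fin_sup_in (fun h => pos_part (`|xi (X^~ w) K f h x| -
      majorant n kappa f K h x)) (@bandwidths_finite R d n) (@bandwidth_one R d n).
    rewrite kh in hE.
    exact: (@powR_le_hits x w (k, k) (false, true)) hE.
  rewrite image2E.
  have [[h eta] [/= /bwP[k kh] /bwP[l lh]] hE] := fin_sup_in (uncurry (fun h eta =>
    pos_part (`|xi2 (X^~ w) K f h eta x| -
      majorant n kappa f Q (max_rV h eta) x)))
    (finite_setX (@bandwidths_finite R d n) (@bandwidths_finite R d n))
    (x := (const_mx 1, const_mx 1)) (conj (@bandwidth_one R d n) (@bandwidth_one R d n)).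
  rewrite kh lh in hE.
  exact: (@powR_le_hits x w (k, l) (false, false)) hE.
apply: (le_trans (maxq _ _)); apply: lerD.
  have [h /bwP[k kh] hE] := fin_sup_in (fun h => pos_part (`|Ahat (X^~ w) K h x -
    Aex f K h x| - majorant n kappa f K h x))
    (@bandwidths_finite R d n) (@bandwidth_one R d n).
  rewrite kh in hE.
  exact: (@powR_le_hits x w (k, k) (true, true)) hE.
have [h /bwP[k kh] hE] := fin_sup_in (fun h => pos_part (`|Ahat (X^~ w) Q h x -
  Aex f Q h x| - majorant n kappa f Q h x))
  (@bandwidths_finite R d n) (@bandwidth_one R d n).
rewrite kh in hE.
exact: (@powR_le_hits x w (k, k) (true, false)) hE.
Qed.

Let card_index : (#|{: index}| <= 4 * (n ^ d * n ^ d))%N.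
Proof.
by rewrite !card_prod !card_bool mulnC leq_mul// leq_mul// card_grid_le.
Qed.

Lemma moment_at_point x :
  ('E_P[fun w => (zeta (X^~ w) kappa K f x `^ q
                  + chi (X^~ w) kappa K f x `^ q)%R] <=
  (W `^ q * (4 * (n%:R ^+ d * n%:R ^+ d)) *
    (36 * (n%:R * cube_mass f x) * n%:R `^ (- (D / 2))))%:E)%E.
Proof.
rewrite unlock.
apply: (@le_trans _ _ (\int[P]_w (W `^ q * \sum_i \1_(event x i) w)%:E)%E).
  apply: le_nonneg_integral => w; rewrite lee_fin; last exact: zeta_chi_le.
  by rewrite addr_ge0 ?powR_ge0.
have mev : measurable_fun [set: Omega] (fun w => (\sum_i \1_(event x i) w) : R).
  by apply: measurable_sum => i; exact: measurable_indic.
under eq_integral do rewrite EFinM.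
rewrite ge0_integralZl_EFin ?powR_ge0//; last 2 first.
- by move=> w _; rewrite lee_fin sumr_ge0.
- exact/measurable_EFinP.
under eq_integral do rewrite -sumEFin.
rewrite ge0_integral_sum//; last first.
  by move=> i; apply/measurable_EFinP; exact: measurable_indic.
rewrite -mulrA EFinM; apply: lee_wpmul2l; first by rewrite lee_fin powR_ge0.
set delta := 36 * _ * _.
have delta0 : 0 <= delta.
  by rewrite /delta !mulr_ge0 ?powR_ge0 ?cube_mass_ge0// ltW.
apply: (@le_trans _ _ (\sum_(i : index) delta%:E)%E).
  apply: lee_sum => i _; rewrite integral_indic// setIT.
  by have := event_prob x i; rewrite -lee_fin fineK// fin_num_measure.
rewrite sumEFin lee_fin sumr_const -[leLHS]mulr_natl; apply: ler_wpM2r => //.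
by rewrite -!natrX -!natrM ler_nat card_index.
Qed.

(** The deviations are at most of order [n ^ d], there are at most [n ^ (2 * d)] pairs
    of bandwidths, and each excess has probability of order
    [n ^ (1 - D / 2) * cube_mass x].  The value of [D] leaves room to spare. *)
Lemma integrated_moment_le :
  (\int[leb]_x 'E_P[fun w => (zeta (X^~ w) kappa K f x `^ q
                              + chi (X^~ w) kappa K f x `^ q)%R]
   <= (144 * (2 * B) `^ q * 2 ^+ d * n%:R `^ (- (q / 2)))%:E)%E.
Proof.
set c := W `^ q * (4 * (n%:R ^+ d * n%:R ^+ d)) * (36 * n%:R * n%:R `^ (- (D / 2))).
have c0 : 0 <= c.
  by rewrite /c !mulr_ge0 ?powR_ge0 ?exprn_ge0// ltW.
apply: (@le_trans _ _ (\int[leb]_x (c%:E * (cube_mass f x)%:E))%E).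
  apply: le_nonneg_integral => x.
    rewrite unlock; apply: integral_ge0 => w _.
    by rewrite lee_fin addr_ge0 ?powR_ge0.
  apply: (le_trans (moment_at_point x)).
  by rewrite -EFinM lee_fin /c le_eqVlt; apply/orP; left; apply/eqP; ring.
rewrite ge0_integralZl_EFin//; last 2 first.
- by move=> x _; rewrite lee_fin cube_mass_ge0.
- exact: measurable_cube_mass.
rewrite integral_cube_mass// -EFinM lee_fin.
have nN0 : n%:R != 0 :> R by rewrite gt_eqF.
have WE : W `^ q = (2 * B) `^ q * n%:R `^ (d%:R * q).
  have B2 : 0 <= 2 * B := mulr_ge0 (ler0n R 2) (le_trans ler01 B_ge1).
  rewrite /W mulrA (powRM _ B2 (exprn_ge0 _ (ltW n0))).
  by rewrite -powR_mulrn// -powRrM.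
have -> : c * 2 ^+ d = 144 * (2 * B) `^ q * 2 ^+ d *
    (n%:R `^ (d%:R * q) * (n%:R ^+ d * n%:R ^+ d) * n%:R * n%:R `^ (- (D / 2))).
  by rewrite /c WE; ring.
apply: ler_wpM2l.
  by rewrite !mulr_ge0 ?powR_ge0 ?exprn_ge0.
rewrite -!powR_mulrn// -[X in _ * X * _](powRr1 (ltW n0)).
rewrite -!powRD ?nN0 ?implybT//; apply: ler_powR => //.
(* The total power of [n] is [d q + 2 d + 1 - D / 2 = - (d + 1) q - 1]. *)
rewrite /D; have d0 : 0 <= d%:R :> R by exact: ler0n.
have dq : 0 <= d%:R * (q - 1) by rewrite mulr_ge0// subr_ge0.
move: q_ge1 dq d0; move: (d%:R : R) => u q1' dq u0; lra.
Qed.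

End stochastic_errors.

Theorem theorem1 (R : realType) (d : nat) (hd : (0 < d)%N) :
  (forall (n : nat) (K f : 'rV[R]_d -> R) (kappa : R)
      (dO : measure_display) (Omega : measurableType dO)
      (P : probability Omega R) (X : 'I_n -> {RV P >-> 'rV[R]_d})
      (hhat : 'rV[R]_d -> Omega -> 'rV[R]_d),
    (exists m, n = (2 ^ m)%N) ->
    is_kernel K -> is_density f -> 0 < kappa ->
    iid_with_density X f ->
    is_bandwidth_selector X kappa K hhat ->
    forall (x : 'rV[R]_d) (w : Omega),
      `|fhat (X^~ w) K (hhat x w) x - f x|
      <= oracle_bound n kappa K f x
         + 7 * zeta (X^~ w) kappa K f x + 18 * chi (X^~ w) kappa K f x)
  /\
  (forall q Kinf : R, 1 <= q ->
    exists C : R,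
    forall (n : nat) (K f : 'rV[R]_d -> R) (kappa : R)
      (dO : measure_display) (Omega : measurableType dO)
      (P : probability Omega R) (X : 'I_n -> {RV P >-> 'rV[R]_d}),
    (exists m, n = (2 ^ m)%N) ->
    is_kernel K -> supnorm K = Kinf -> is_density f -> 0 < kappa ->
    iid_with_density X f ->
    (Num.max Kinf 1) ^+ 2 * ((4 * d%:R + 2) * q + 4 * (d%:R + 1)) <= kappa ->
    (3 <= n)%N ->
    (\int[@lebesgue_rV R d]_x
       'E_P[fun w => (zeta (X^~ w) kappa K f x `^ q
                      + chi (X^~ w) kappa K f x `^ q)%R]
     <= (C * n%:R `^ (- (q / 2)))%:E)%E).
Proof.
split=> [n K f kappa dO Omega P X hhat [m nE] kerK denf kappa0 _ sel x w|q Kinf q1].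
  have [_ /(_ w) argmin] := sel x.
  by apply: oracle_inequality => //; rewrite nE expn_gt0.
exists (144 * (2 * Num.max Kinf 1 ^+ 2) `^ q * 2 ^+ d).
move=> n K f kappa dO Omega P X _ kerK KE denf _ iidX kappa_ge n3.
rewrite -KE in kappa_ge *; exact: integrated_moment_le.
Qed.
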